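(* There exist absolute constants $C,c_1,c_2,c_3,c_4>0$ such that for all $d\ge1$ and all $n\ge \max\{d,3\}$ the following hold for the multidimensional ERM estimator $\hat{\boldsymbol f}_{\mathsf{erm}}$: (1) if $\pi$ is supported on $[0,h]^d$, then $\mathsf{Regret}_\pi(\hat{\boldsymbol f}_{\mathsf{erm}})\le C\frac dn\max\{c_1,c_2h\}^{d+2}\big(\frac{\log n}{\log\log n}\big)^{d+1}$; (2) if every one-dimensional marginal of $\pi$ belongs to $\mathsf{SubE}(s)$ for some $s>0$, then $\mathsf{Regret}_\pi(\hat{\boldsymbol f}_{\mathsf{erm}})\le C\frac dn(\max\{c_3,c_4s\}\log n)^{d+2}$.
   Context: Multidimensional Poisson model. Let $\pi$ be a distribution on $\mathbb R_+^d$. Draw $\boldsymbol\theta\sim\pi$ and, given $\boldsymbol\theta$, let the coordinates $X_j\sim\mathrm{Poi}(\theta_j)$ be independent. The mixture pmf is $p_\pi(\boldsymbol x)=\int\prod_{j=1}^d e^{-\theta_j}\theta_j^{x_j}/x_j!\,d\pi(\boldsymbol\theta)$ for $\boldsymbol x\in\mathbb Z_+^d$. The Bayes estimator is $\boldsymbol f^*=(f^*_1,\dots,f^*_d)$ with $f^*_j(\boldsymbol x)=\mathbb E[\theta_j\mid\boldsymbol X=\boldsymbol x]=(x_j+1)p_\pi(\boldsymbol x+\boldsymbol e_j)/p_\pi(\boldsymbol x)$, where $\boldsymbol e_j$ is the $j$-th standard basis vector. The training sample $\boldsymbol X_1,\dots,\boldsymbol X_n$ is i.i.d. from $p_\pi$.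 Function class: $\boldsymbol{\mathcal F}=\{\boldsymbol f=(f_1,\dots,f_d):\mathbb Z_+^d\to\mathbb R_+^d:\ f_j(\boldsymbol x)\le f_j(\boldsymbol x+\boldsymbol e_j)\ \forall j,\forall\boldsymbol x\}$. The convention is $f_j(\boldsymbol x)=0$ whenever $x_j=-1$. ERM: $\hat{\boldsymbol f}_{\mathsf{erm}}$ minimizes $\frac1n\sum_{i=1}^n\big[\|\boldsymbol f(\boldsymbol X_i)\|^2-2\sum_{j=1}^dX_{ij}f_j(\boldsymbol X_i-\boldsymbol e_j)\big]$ over $\boldsymbol{\mathcal F}$. Its $j$-th coordinate is uniquely determined on $S_j=\{\boldsymbol X_i\}\cup\{\boldsymbol X_i-\boldsymbol e_j\}$. It is extended as follows: for $\boldsymbol x\notin S_j$, if some $y\ge0$ has $\boldsymbol x-y\boldsymbol e_j\in S_j$, set the value equal to that at $\boldsymbol x-y\boldsymbol e_j$ for the smallest such $y$; otherwise set it to $0$. Regret: $\mathsf{Regret}_\pi(\boldsymbol f)=\mathbb E\|\boldsymbol f(\boldsymbol X)-\boldsymbol\theta\|^2-\mathbb E\|\boldsymbol f^*(\boldsymbol X)-\boldsymbol\theta\|^2$, where $(\boldsymbol\theta,\boldsymbol X)$ is a fresh draw independent of the training sample, and the expectation is also over the training sample. $\mathsf{SubE}(s)=\{G \text{ distribution on }\mathbb R_+: G([t,\infty))\le 2e^{-t/s}\ \forall t>0\}$. *)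

(* Defs.v *)
From HB Require Import structures.
From mathcomp Require Import all_boot all_order all_algebra.
From mathcomp Require Import all_classical all_reals all_analysis.
Set Implicit Arguments. Unset Strict Implicit. Unset Printing Implicit Defensive.
Import Order.TTheory GRing.Theory Num.Theory.
Local Open Scope classical_set_scope.
Local Open Scope ring_scope.

Section PoissonERM.
Variable R : realType.

Definition pt (d : nat) := {ffun 'I_d -> nat}.
Definition sample (d n : nat) := {ffun 'I_n -> pt d}.
Definition estimator (d : nat) := pt d -> 'I_d -> R.

Definition incr d (j : 'I_d) (x : pt d) : pt d :=
  [ffun k => if k == j then (x k).+1 else x k].
(* x - y e_j  (only used when y <= x_j) *)
Definition subj d (j : 'I_d) (y : nat) (x : pt d) : pt d :=
  [ffun k => if k == j then (x k - y)%N else x k].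

Definition poi_lik d (x : pt d) (th : 'I_d -> R) : R :=
  \prod_(j < d) (expR (- th j) * th j ^+ x j / (x j)`!%:R).

Section Model.
Context (d : nat) (d0 : measure_display) (T : measurableType d0)
        (P : probability T R) (theta : 'I_d -> T -> R).

Definition pmf (x : pt d) : R :=
  fine (\int[P]_t (poi_lik x (fun j => theta j t))%:E)%E.

Definition bayes : estimator d :=
  fun x j => (x j).+1%:R * pmf (incr j x) / pmf x.

Definition risk (f : estimator d) : \bar R :=
  (\int[P]_t \esum_(x in [set: pt d])
      (poi_lik x (fun j => theta j t) *
       \sum_(j < d) (f x j - theta j t) ^+ 2)%:E)%E.

Definition regret (n : nat) (fhat : sample d n -> estimator d) : \bar R :=
  (\esum_(s in [set: sample d n]) ((\prod_(i < n) pmf (s i))%:E * risk (fhat s))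
   - risk bayes)%E.
End Model.

Definition in_F d (f : estimator d) : Prop :=
  forall (x : pt d) (j : 'I_d), 0 <= f x j /\ f x j <= f (incr j x) j.

(* empirical objective
   1/n sum_i [ ||f(X_i)||^2 - 2 sum_j X_ij f_j(X_i - e_j) ]
   (the term with X_ij = 0 vanishes, matching the convention f_j = 0 at x_j=-1) *)
Definition emp_obj d n (s : sample d n) (f : estimator d) : R :=
  n%:R^-1 * \sum_(i < n)
    (\sum_(j < d) f (s i) j ^+ 2
     - 2 * \sum_(j < d) (s i j)%:R * f (subj j 1 (s i)) j).

Definition Sj d n (s : sample d n) (j : 'I_d) : set (pt d) :=
  [set x | exists i : 'I_n, x = s i \/ (0 < s i j)%N /\ x = subj j 1 (s i)].

Definition is_erm d n (s : sample d n) (f : estimator d) : Prop :=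
  in_F f /\
  (forall g, in_F g -> emp_obj s f <= emp_obj s g) /\
  (forall (j : 'I_d) (x : pt d), ~ Sj s j x ->
     ((forall y, (y <= x j)%N -> ~ Sj s j (subj j y x)) -> f x j = 0) /\
     (forall y, (y <= x j)%N -> Sj s j (subj j y x) ->
        (forall y', (y' < y)%N -> ~ Sj s j (subj j y' x)) ->
        f x j = f (subj j y x) j)).

End PoissonERM.

(* Main.v *)
(* Since the observations are integer vectors, the ERM can be analysed cell by
   cell, without chaining or symmetrization.  Fix a coordinate [j], let [f] be the
   [j]-th coordinate of the ERM, [f*] that of the Bayes estimator, [N x] the number
   of sample points equal to [x], and [Z x = f* x N x - (x_j + 1) N (x + e_j)],
   which is centered with second moment [n p(x) f* x (f* x + x_j + 1)].
   Comparing the objective of the ERM with that of the monotone competitor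
   [g = min(f*, B)] gives
     sum_x N x (f x - g x)^2 <= 2 sum_x Z_g x (g x - f x),
   where [Z_g] is [Z] with [g] in place of [f*].  Inside the cube [[0, M)^d], AM-GM
   with the deterministic weight [n p(x)] instead of the random [N x] makes the
   right-hand side cost [f* x (f* x + x_j + 1)] per cell.  Replacing [N x] by
   [n p(x)] on the left fails only when [N x < n p(x) / 4], an event of
   probability at most [exp (- n p(x) / 4)]; there [f <= max_i X_ij] suffices.
   For priors on [[0, h]^d] one has [p(x + e_j) <= p(x) / 2] as soon as
   [x_j + 1 >= 2 h], so that [sum_x n p(x) exp (- n p(x) / 4)] over a line in
   direction [j] is [O(1 + h)] instead of [O(M)]; this saves the extra logarithm.
   The truncations at [M] and [B] are controlled by exponential moments, those
   of [f*] through Jensen's inequality. *)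

Require Import Defs.
From HB Require Import structures.
From mathcomp Require Import all_boot all_order all_algebra.
From mathcomp Require Import all_classical all_reals all_analysis.
From mathcomp Require Import measurable_realfun ring lra.
Import Order.TTheory GRing.Theory Num.Theory.
Local Open Scope classical_set_scope.
Local Open Scope ring_scope.
Set Implicit Arguments. Unset Strict Implicit. Unset Printing Implicit Defensive.

(** * Sums with nonnegative weights *)

Section Expectation.
Variables (R : realType) (K : choiceType).
Implicit Types (w F G : K -> R) (c e : R).
Local Open Scope ereal_scope.

(** Expectation under the mass function [w], used both for the mixture on points and for the product
    law on samples. Values in [\bar R] remove summability conditions, at the price of working with
    nonnegative integrands. *)
Definition expect w F : \bar R := \esum_(x in [set: K]) (w x * F x)%:E.

(** One inequality passes through finite subsets; the converse is the same inequality for the factor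
    [c^-1]. *)
Lemma esumZl c (a : K -> \bar R) : (0 <= c)%R -> (forall x, 0 <= a x) ->
  \esum_(x in [set: K]) (c%:E * a x) = c%:E * \esum_(x in [set: K]) a x.
Proof.
rewrite le_eqVlt => /predU1P[<-|c0] a0.
  by rewrite mul0e esum1// => x _; rewrite mul0e.
have half c' (a' : K -> \bar R) : (0 < c')%R -> (forall x, 0 <= a' x) ->
    \esum_(x in [set: K]) (c'%:E * a' x) <= c'%:E * \esum_(x in [set: K]) a' x.
  move=> c0' a0'; apply: ge_ereal_sup => _ [X [finX _]] <-.
  rewrite -ge0_mule_fsumr// lee_pmul2l//.
  by apply: ereal_sup_ubound; exists X.
apply/eqP; rewrite eq_le half//= -lee_pdivlMl//.
apply: le_trans (half _ _ _ _); rewrite ?invr_gt0//; last first.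
  by move=> x; rewrite mule_ge0// lee_fin ltW.
apply: le_esum => x _; rewrite muleA -EFinM mulVf ?mul1e// gt_eqF//.
Qed.

Lemma expect_ge0 w F : (forall x, 0 <= w x)%R -> (forall x, 0 <= F x)%R ->
  0 <= expect w F.
Proof. by move=> w0 F0; apply: esum_ge0 => x _; rewrite lee_fin mulr_ge0. Qed.

Lemma le_expect w F G : (forall x, 0 <= w x)%R ->
  (forall x, F x <= G x)%R -> expect w F <= expect w G.
Proof. by move=> w0 FG; apply: le_esum => x _; rewrite lee_fin ler_wpM2l. Qed.

Lemma eq_expect w F G : F =1 G -> expect w F = expect w G.
Proof. by move=> FG; apply: eq_esum => x _; rewrite FG. Qed.

Lemma expectD w F G : (forall x, 0 <= w x)%R ->
  (forall x, 0 <= F x)%R -> (forall x, 0 <= G x)%R ->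
  expect w (fun x => F x + G x)%R = expect w F + expect w G.
Proof.
move=> w0 F0 G0; rewrite /expect -esumD.
- by apply: eq_esum => x _; rewrite mulrDr EFinD.
- by move=> x _; rewrite lee_fin mulr_ge0.
- by move=> x _; rewrite lee_fin mulr_ge0.
Qed.

Lemma expectZ w F c : (forall x, 0 <= w x)%R -> (forall x, 0 <= F x)%R ->
  (0 <= c)%R -> expect w (fun x => c * F x)%R = c%:E * expect w F.
Proof.
move=> w0 F0 c0; rewrite /expect -esumZl//.
- by apply: eq_esum => x _; rewrite mulrCA EFinM.
- by move=> x; rewrite lee_fin mulr_ge0.
Qed.

Lemma expect_sum w (I : Type) (r : seq I) (P : pred I) (F : I -> K -> R) :
  (forall x, 0 <= w x)%R -> (forall i x, 0 <= F i x)%R ->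
  expect w (fun x => \sum_(i <- r | P i) F i x)%R =
  \sum_(i <- r | P i) expect w (F i).
Proof.
move=> w0 F0; rewrite /expect.
elim: r => [|i r IH].
  by rewrite big_nil esum1// => x _; rewrite big_nil mulr0.
rewrite big_cons; case: ifP => Pi; rewrite -IH; last first.
  by apply: eq_esum => x _; rewrite big_cons Pi.
rewrite -esumD.
- by apply: eq_esum => x _; rewrite big_cons Pi mulrDr EFinD.
- by move=> x _; rewrite lee_fin mulr_ge0.
- by move=> x _; rewrite lee_fin mulr_ge0// sumr_ge0.
Qed.

Lemma expect_leD w F G c e : (forall x, 0 <= w x)%R ->
  (forall x, 0 <= F x)%R -> (forall x, 0 <= G x)%R ->
  expect w F <= c%:E -> expect w G <= e%:E ->
  expect w (fun x => F x + G x)%R <= (c + e)%:E.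
Proof. by move=> w0 F0 G0 Fc Ge; rewrite expectD// EFinD leeD. Qed.

Lemma expect_leZ w F c e : (forall x, 0 <= w x)%R -> (forall x, 0 <= F x)%R ->
  (0 <= c)%R -> expect w F <= e%:E ->
  expect w (fun x => c * F x)%R <= (c * e)%:E.
Proof. by move=> w0 F0 c0 Fe; rewrite expectZ// EFinM lee_wpmul2l. Qed.

Lemma expect_le_sum w (I : Type) (r : seq I) (P : pred I) (F : I -> K -> R)
    (c : I -> R) :
  (forall x, 0 <= w x)%R -> (forall i x, 0 <= F i x)%R ->
  (forall i, P i -> expect w (F i) <= (c i)%:E) ->
  expect w (fun x => \sum_(i <- r | P i) F i x)%R <= (\sum_(i <- r | P i) c i)%:E.
Proof.
by move=> w0 F0 Fc; rewrite expect_sum// -sumEFin; apply: lee_sum => i /Fc.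
Qed.

Lemma expect_point w F x : (forall x, 0 <= w x)%R -> (forall x, 0 <= F x)%R ->
  (w x * F x)%:E <= expect w F.
Proof.
move=> w0 F0; apply: esum_ge; exists [set x]; last by rewrite fsbig_set1.
by split=> //; exact: finite_set1.
Qed.

Lemma expect_delta w x : (forall x, 0 <= w x)%R ->
  expect w (fun y => (y == x)%:R) = (w x)%:E.
Proof.
move=> w0; rewrite /expect (esumID [set x]) => [|y _]; last first.
  by rewrite lee_fin mulr_ge0.
rewrite setTI esum_set1 ?eqxx ?mulr1 ?lee_fin// esum1 ?adde0// => y [_ /= yx].
by case: eqP => // _; rewrite mulr0.
Qed.

(** Extracts a real value from a bounded expectation, so that later computations can subtract. *)
Lemma expect_fin w F c : (forall x, 0 <= w x)%R -> (forall x, 0 <= F x)%R ->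
  expect w F <= c%:E -> {e | (0 <= e <= c)%R & expect w F = e%:E}.
Proof.
move=> w0 F0; have := expect_ge0 w0 F0.
by case: (expect w F) => // e; rewrite !lee_fin => e0 ec; exists e; rewrite ?e0.
Qed.

End Expectation.

(** * Sums of product weights over finite families *)

Section ProductExpectation.
Variables (R : realType) (K : choiceType).

Let cons_ffun n (z : K * {ffun 'I_n -> K}) : {ffun 'I_n.+1 -> K} :=
  [ffun i => oapp z.2 z.1 (unlift ord0 i)].

Let cons_ffun_bij n : set_bij [set: K * {ffun 'I_n -> K}] [set: _] (@cons_ffun n).
Proof.
split=> //.
- move=> [x s] [y t] _ _ /ffunP st; congr (_, _).
    by have := st ord0; rewrite !ffunE unlift_none.
  by apply/ffunP => i; have := st (lift ord0 i); rewrite !ffunE liftK.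
- move=> s _; exists (s ord0, [ffun i => s (lift ord0 i)]) => //.
  apply/ffunP => i; rewrite ffunE.
  by case: unliftP => [k|] -> //=; rewrite ffunE.
Qed.

(** Tonelli by induction on [n]: [cons_ffun] splits a family into its value at [ord0] and the rest,
    and the inner sum is a constant that factors out. *)
Lemma esum_prod_ffun n (a : 'I_n -> K -> R) (c : 'I_n -> R) :
  (forall i x, 0 <= a i x) ->
  (forall i, (\esum_(x in [set: K]) (a i x)%:E = (c i)%:E)%E) ->
  (\esum_(s in [set: {ffun 'I_n -> K}]) (\prod_i a i (s i))%:E =
   (\prod_i c i)%:E)%E.
Proof.
elim: n a c => [|n IH] a c a0 ac.
  rewrite big_ord0 (_ : [set: _] = [set ffun0 (card_ord 0)]).
    by rewrite esum_set1 big_ord0// lee_fin.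
  by apply/seteqP; split => // s _ /=; apply/ffunP => -[].
rewrite (reindex_esum _ _ _ _ (@cons_ffun_bij n)).
transitivity (\esum_(x in [set: K]) \esum_(s in [set: {ffun 'I_n -> K}])
    ((a ord0 x)%:E * (\prod_i a (lift ord0 i) (s i))%:E))%E.
  rewrite esum_esum; last first.
    by move=> x s _ _; rewrite -EFinM lee_fin mulr_ge0// prodr_ge0.
  rewrite (_ : _ `*`` _ = setT); last by apply/seteqP; split.
  apply: eq_esum => -[x s] _; rewrite big_ord_recl ffunE unlift_none /= EFinM.
  by under eq_bigr do rewrite ffunE liftK /=.
under eq_esum => x _.
  rewrite esumZl//; last by move=> s; rewrite lee_fin prodr_ge0.
  rewrite (IH (fun i => a (lift ord0 i)) (fun i => c (lift ord0 i)))//.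
  rewrite muleC; over.
rewrite esumZl//.
- by rewrite ac -EFinM big_ord_recl mulrC.
- apply: prodr_ge0 => i _; rewrite -lee_fin -ac; apply: esum_ge0 => x _.
  by rewrite lee_fin.
- by move=> x; rewrite lee_fin.
Qed.

End ProductExpectation.

(** * Cell counts of an i.i.d. sample *)

Section IidSample.
Variables (R : realType) (K : choiceType) (n : nat) (p : K -> R).
Hypothesis p_ge0 : forall x, 0 <= p x.
Hypothesis p_sum1 : expect p (fun=> 1) = 1%:E.
Local Notation sample := {ffun 'I_n -> K}.
Implicit Types (s : sample) (x y : K).

Definition iid_weight s : R := \prod_i p (s i).
Local Notation W := iid_weight.

Lemma iid_weight_ge0 s : 0 <= W s. Proof. exact: prodr_ge0. Qed.
Local Hint Resolve iid_weight_ge0 : core.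

(** Independence of the sample points. Marginals of one or two points follow by taking all other
    factors equal to 1. *)
Lemma expect_prod (phi : 'I_n -> K -> R) (c : 'I_n -> R) :
  (forall i x, 0 <= phi i x) -> (forall i, expect p (phi i) = (c i)%:E) ->
  expect W (fun s => \prod_i phi i (s i)) = (\prod_i c i)%:E.
Proof.
move=> phi0 phic.
rewrite -(@esum_prod_ffun R K n (fun i x => p x * phi i x)) => [|i x|//].
  by apply: eq_esum => s _; rewrite big_split.
exact: mulr_ge0.
Qed.

Lemma expect_cst c : 0 <= c -> expect p (fun=> c) = c%:E.
Proof.
move=> c0; rewrite (eq_expect _ (G := fun x => c * 1)) => [|x]; last by rewrite mulr1.
by rewrite expectZ// p_sum1 mule1.
Qed.

Lemma expect_iid_cst c : 0 <= c -> expect W (fun=> c) = c%:E.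
Proof.
move=> c0; rewrite (eq_expect _ (G := fun s => c * \prod_(i < n) 1)); last first.
  by move=> s /=; rewrite big1_eq mulr1.
rewrite expectZ//; last by move=> s; rewrite big1_eq.
by rewrite (@expect_prod (fun _ _ => 1) (fun=> 1))// big1_eq mule1.
Qed.

Lemma expect_coord i (phi : K -> R) c : (forall x, 0 <= phi x) ->
  expect p phi = c%:E -> expect W (fun s => phi (s i)) = c%:E.
Proof.
move=> phi0 phic.
rewrite (eq_expect _
  (G := fun s => \prod_k (if k == i then phi (s k) else 1))); last first.
  by move=> s /=; rewrite (bigD1 i)//= eqxx big1 ?mulr1// => k /negPf ->.
rewrite (@expect_prod (fun k x => if k == i then phi x else 1)
  (fun k => if k == i then c else 1)).
- by rewrite (bigD1 i)//= eqxx big1 ?mulr1// => k /negPf ->.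
- by move=> k x; case: ifP.
- by move=> k; case: ifP.
Qed.

Lemma expect_coord_le i (phi : K -> R) c : (forall x, 0 <= phi x) ->
  (expect p phi <= c%:E)%E -> (expect W (fun s => phi (s i)) <= c%:E)%E.
Proof.
move=> phi0 /(expect_fin p_ge0 phi0)[e /andP[_ ec] pe].
by rewrite (expect_coord i phi0 pe) lee_fin.
Qed.

Lemma expect_sum_coord_le (phi : K -> R) c : (forall x, 0 <= phi x) ->
  (expect p phi <= c%:E)%E ->
  (expect W (fun s => \sum_i phi (s i))%R <= (n%:R * c)%:E)%E.
Proof.
move=> phi0 phic.
apply: le_trans (@expect_le_sum _ _ _ _ _ _ _ (fun=> c) _ _ _) _ => //.
  by move=> i _; exact: expect_coord_le.
by rewrite sumr_const card_ord mulr_natl.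
Qed.

Lemma expect_coord2 i k (phi psi : K -> R) c e : i != k ->
  (forall x, 0 <= phi x) -> (forall x, 0 <= psi x) ->
  expect p phi = c%:E -> expect p psi = e%:E ->
  expect W (fun s => phi (s i) * psi (s k)) = (c * e)%:E.
Proof.
move=> ik phi0 psi0 phic psie.
have ki : (k == i) = false by rewrite eq_sym; exact: negPf.
rewrite (eq_expect _ (G := fun s => \prod_l
    (if l == i then phi (s l) else if l == k then psi (s l) else 1))); last first.
  move=> s /=; rewrite (bigD1 i)//= eqxx (bigD1 k) ?ki//=.
  rewrite eqxx big1 ?mulr1// => l /andP[].
  by move=> /negPf -> /negPf ->.
rewrite (@expect_prod
  (fun l x => if l == i then phi x else if l == k then psi x else 1)
  (fun l => if l == i then c else if l == k then e else 1)).
- rewrite (bigD1 i)//= eqxx (bigD1 k) ?ki//=.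
  rewrite eqxx big1 ?mulr1// => l /andP[].
  by move=> /negPf -> /negPf ->.
- by move=> l x; do 2 case: ifP => // _.
- by move=> l; do 2 case: ifP => // _; exact: expect_cst.
Qed.

Definition count_occ s x : R := \sum_i (s i == x)%:R.
Local Notation N := count_occ.

Lemma count_occ_ge0 s x : 0 <= N s x.
Proof. exact: sumr_ge0. Qed.
Local Hint Resolve count_occ_ge0 : core.

Lemma expect_count x : expect W (N ^~ x) = (n%:R * p x)%:E.
Proof.
rewrite expect_sum// (eq_bigr (fun=> (p x)%:E)) => [|i _].
  by rewrite sumEFin sumr_const card_ord mulr_natl.
by apply: (@expect_coord i (fun y => (y == x)%:R)) => //; exact: expect_delta.
Qed.

(** Expand into pairs of sample points: the [n] diagonal pairs contribute only if [x = y], the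
    [n (n - 1)] others are independent. *)
Lemma expect_count2 x y : expect W (fun s => N s x * N s y) =
  (n%:R * ((x == y)%:R * p x) + (n%:R * n.-1%:R) * (p x * p y))%:E.
Proof.
rewrite (eq_expect _ (G := fun s => \sum_i \sum_k (s i == x)%:R * (s k == y)%:R)).
  rewrite expect_sum => [|//|i s]; last by apply: sumr_ge0 => k _; rewrite mulr_ge0.
  rewrite (eq_bigr (fun=> ((x == y)%:R * p x + n.-1%:R * (p x * p y))%:E)) => [|i _].
    by rewrite sumEFin sumr_const card_ord -mulr_natl; congr EFin; ring.
  rewrite expect_sum => [|//|k s]; last by rewrite mulr_ge0.
  rewrite (bigD1 i)//= EFinD; congr (_ + _)%E.
    rewrite (eq_expect _ (G := fun s => (x == y)%:R * (s i == x)%:R)).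
      rewrite expectZ// (@expect_coord i (fun z => (z == x)%:R) (p x))//.
      exact: expect_delta.
    by move=> s /=; case: eqVneq => [->|_]; rewrite ?mulr1n ?mulr0n ?mulr0 ?mul0r ?mulr1 ?mul1r.
  rewrite (eq_bigr (fun=> (p x * p y)%:E)) => [|k ki].
    by rewrite sumEFin sumr_const cardC1 card_ord mulr_natl.
  apply: (@expect_coord2 i k (fun z => (z == x)%:R) (fun z => (z == y)%:R)) => //.
  - by rewrite eq_sym.
  - exact: expect_delta.
  - exact: expect_delta.
move=> s /=; rewrite mulr_suml; apply: eq_bigr => i _; by rewrite mulr_sumr.
Qed.

(** The balance condition centers [a N x - b N y], so only the diagonal pairs survive in its second
    moment. It is applied with [y = x + e_j], [a] the Bayes estimate and [b = x_j + 1]. *)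
Lemma expect_count_balance x y a b : x != y -> 0 <= a -> 0 <= b ->
  a * p x = b * p y ->
  (expect W (fun s => (a * N s x - b * N s y) ^+ 2)%R <=
   (n%:R * (a * (a + b) * p x))%:E)%E.
Proof.
move=> xy a0 b0 ab.
have yx : (y == x) = false by rewrite eq_sym; exact: negPf.
have NN0 u v s : 0 <= N s u * N s v by exact: mulr_ge0.
have F0 s : 0 <= (a * N s x - b * N s y) ^+ 2 by exact: sqr_ge0.
have cross : expect W (fun s => 2 * a * b * (N s x * N s y)) =
    (2 * a * b * (n%:R * n.-1%:R * (p x * p y)))%:E.
  rewrite expectZ ?mulr_ge0// expect_count2 (negPf xy).
  by rewrite mul0r mulr0 add0r.
(* The negative cross term is moved to the other side, because [expect] is additive only on
   nonnegative functions. *)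
have : (expect W (fun s => (a * N s x - b * N s y) ^+ 2)%R +
    expect W (fun s => 2 * a * b * (N s x * N s y))%R =
    (a ^+ 2 * (n%:R * p x + n%:R * n.-1%:R * (p x * p x)) +
     b ^+ 2 * (n%:R * p y + n%:R * n.-1%:R * (p y * p y)))%:E)%E.
  rewrite -expectD => [|//|//|s]; last by rewrite !mulr_ge0.
  rewrite (eq_expect _ (G := fun s => a ^+ 2 * (N s x * N s x) +
    b ^+ 2 * (N s y * N s y))) => [|s /=]; last by ring.
  rewrite expectD => [||s|s]; rewrite ?mulr_ge0 ?sqr_ge0//.
  rewrite !expectZ ?sqr_ge0// !expect_count2 !eqxx !mul1r.
  by rewrite -EFinM.
rewrite cross; have := expect_ge0 iid_weight_ge0 F0.
case: (expect W _) => // e; rewrite !lee_fin -EFinD => e0 [eE].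
have -> : e = a ^+ 2 * (n%:R * p x + n%:R * n.-1%:R * (p x * p x)) +
    b ^+ 2 * (n%:R * p y + n%:R * n.-1%:R * (p y * p y)) -
    2 * a * b * (n%:R * n.-1%:R * (p x * p y)).
  by rewrite -eE addrK.
rewrite le_eqVlt; apply/orP; left; apply/eqP.
(* The off-diagonal terms form a perfect square, which the balance makes zero. *)
transitivity (n%:R * (a * (a * p x) + b * (b * p y)) +
  n%:R * n.-1%:R * (a * p x - b * p y) ^+ 2); first by ring.
by rewrite -ab subrr expr0n /= mulr0 addr0; ring.
Qed.

(** Chernoff bound with parameter 1. Since [exp (-1) <= 1/2], the Laplace transform of one indicator
    is at most [1 - p x / 2 <= exp (- p x / 2)]; the threshold [n p x / 4] gives back half of the
    resulting exponent. *)
Lemma expect_count_low x :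
  (expect W (fun s => (N s x < n%:R * p x / 4)%R%:R) <=
   (expR (- (n%:R * p x / 4)))%:E)%E.
Proof.
have px1 : p x <= 1.
  have := expect_point x p_ge0 (fun=> ler01 : 0 <= (1 : R)).
  by rewrite p_sum1 mulr1 lee_fin.
have e2 : expR (-1) <= 2^-1 :> R.
  rewrite expRN lef_pV2 ?posrE ?expR_gt0//.
  by apply: le_trans (expR_ge1Dx 1); lra.
pose phi y : R := expR (- (y == x)%:R).
have phi0 y : 0 <= phi y by exact: expR_ge0.
have phiE : exists2 c, expect p phi = c%:E & c <= expR (- (p x / 2)).
  have [] := @expect_fin _ _ p phi 1 p_ge0 phi0.
    rewrite -p_sum1; apply: le_expect => // y.
    by rewrite /phi expR_le1 oppr_le0.
  move=> c /andP[c0 _] pc; exists c => //.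
  apply: le_trans (expR_ge1Dx _).
  have e1 : 0 <= 1 - expR (-1) :> R by lra.
  have : (expect p phi + expect p (fun y => (1 - expR (-1)) * (y == x)%:R)%R)%E = 1%:E.
    rewrite -expectD//.
    rewrite -[RHS]p_sum1; apply: eq_expect => y.
    by rewrite /phi; case: eqP => _; rewrite ?mulr1n ?mulr0n ?oppr0 ?expR0; ring.
  rewrite expectZ//.
  rewrite expect_delta// pc -EFinM -EFinD => -[]; have := p_ge0 x; nra.
have [c pc cle] := phiE.
apply: (@le_trans _ _ (expect W (fun s => expR (n%:R * p x / 4) *
    \prod_i phi (s i))%R)).
  apply: le_expect => // s.
  rewrite -expR_sum -expRD sumrN.
  case: ltP => [lt|_]; last exact: expR_ge0.
  by apply: le_trans (expR_ge1Dx _); rewrite /= lerDl subr_ge0 ltW.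
rewrite expectZ ?expR_ge0//; last by move=> s; exact: prodr_ge0.
rewrite (@expect_prod (fun=> phi) (fun=> c))// prodr_const card_ord -EFinM lee_fin.
have c0 : 0 <= c by rewrite -lee_fin -pc; exact: expect_ge0.
apply: (@le_trans _ _ (expR (n%:R * p x / 4) * expR (- (p x / 2)) ^+ n)).
  by rewrite ler_pM2l ?expR_gt0// lerXn2r// nnegrE expR_ge0.
rewrite -expRM_natl -expRD ler_expR; lra.
Qed.

End IidSample.

(** * Poisson mixtures and the Bayes estimator *)

(** Monotone convergence for series, after enumerating [K] by [pickle_inv] and padding with 0 at the
    naturals that encode no element. *)
Lemma integral_esum (R : realType) (d : measure_display) (T : measurableType d)
    (mu : measure T R) (K : countType) (a : K -> T -> \bar R) :
  (forall x, measurable_fun setT (a x)) -> (forall x t, (0 <= a x t)%E) ->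
  (\int[mu]_t (\esum_(x in [set: K]) a x t) =
   \esum_(x in [set: K]) (\int[mu]_t a x t))%E.
Proof.
move=> ma a0.
pose b k t := (oapp (a ^~ t) 0 (pickle_inv k))%E.
have series (f : K -> \bar R) : (forall x, 0 <= f x)%E ->
    (\esum_(x in [set: K]) f x =
     \sum_(k <oo) oapp f 0 (pickle_inv k))%E.
  move=> f0.
  have g0 k : (0 <= oapp f 0 (@pickle_inv K k))%E by case: pickle_inv => /=.
  rewrite nneseries_esumT// [RHS](esumID (range (@pickle K)))//.
  rewrite setTI [X in (_ = _ + X)%E]esum1 ?adde0; last first.
    move=> k [_ /= nk]; case E : (@pickle_inv K k) => [x|//].
    by case: nk; exists x => //; have := @pickle_invK K k; rewrite E.
  rewrite esum_image => [|x y _ _]; last exact: (pcan_inj pickleK_inv).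
  by apply: eq_esum => x _; rewrite pickleK_inv.
transitivity (\int[mu]_t (\sum_(k <oo) b k t))%E.
  by apply: eq_integral => t _; rewrite series.
rewrite integral_nneseries//; first last.
- by move=> k t _; rewrite /b; case: pickle_inv => /=.
- by move=> k; rewrite /b; case: pickle_inv => [x|] //=; exact: ma.
rewrite [RHS]series; last by move=> x; exact: integral_ge0.
apply: eq_eseriesr => k _; rewrite /b.
by case: pickle_inv => //=; rewrite integral0.
Qed.

(** * The Poisson likelihood and its generating function *)

Section PoissonLikelihood.
Variables (R : realType) (d : nat).
Implicit Types (x : pt d) (th : 'I_d -> R) (j k : 'I_d) (b : R).

(** Probability generating function of the Poisson law: up to the factor [exp (- r)], the sum is the
    exponential series at [b r]. *)
Lemma esum_poisson_gen (r b : R) : 0 <= r -> 0 <= b ->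
  (\esum_(m in [set: nat]) (expR (- r) * r ^+ m / m`!%:R * b ^+ m)%:E =
   (expR ((b - 1) * r))%:E)%E.
Proof.
move=> r0 b0.
have term0 m : 0 <= expR (- r) * r ^+ m / m`!%:R * b ^+ m.
  by rewrite !mulr_ge0 ?expR_ge0 ?exprn_ge0.
have termE m : expR (- r) * r ^+ m / m`!%:R * b ^+ m =
    expR (- r) * ((b * r) ^+ m / m`!%:R).
  by rewrite exprMn -!mulrA; congr (_ * _); rewrite [RHS]mulrCA (mulrC (b ^+ m)).
rewrite -nneseries_esumT; last by move=> m; rewrite lee_fin.
under eq_eseriesr => m _.
  rewrite termE EFinM; over.
rewrite nneseriesZl; last first.
  by move=> m _; rewrite lee_fin divr_ge0// exprn_ge0// mulr_ge0.
rewrite (_ : (b - 1) * r = - r + b * r); last by ring.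
rewrite expRD EFinM; congr *%E.
rewrite expRE -EFin_lim; last first.
  rewrite /pseries/=; under eq_fun do rewrite mulrC.
  exact: is_cvg_series_exp_coeff.
apply/congr_lim/funext => n/=; rewrite /pseries/= /series/= -sumEFin//.
by under eq_bigr do rewrite mulrC.
Qed.

Lemma poi_lik_ge0 x th : (forall j, 0 <= th j) -> 0 <= poi_lik x th.
Proof.
move=> th0; apply: prodr_ge0 => j _.
by rewrite !mulr_ge0 ?expR_ge0 ?exprn_ge0.
Qed.

Lemma esum_poi_lik k th b : (forall j, 0 <= th j) -> 0 <= b ->
  (\esum_(x in [set: pt d]) (poi_lik x th * b ^+ x k)%:E =
   (expR ((b - 1) * th k))%:E)%E.
Proof.
move=> th0 b0.
transitivity (\esum_(x in [set: pt d]) (\prod_j (expR (- th j) * th j ^+ x j /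
    (x j)`!%:R * (if j == k then b else 1) ^+ x j))%:E)%E.
  apply: eq_esum => x _; rewrite big_split /=; congr (_ * _)%:E.
  rewrite (bigD1 k)//= eqxx big1 ?mulr1// => j /negPf ->.
  by rewrite expr1n.
rewrite (@esum_prod_ffun R nat d
  (fun j m => expR (- th j) * th j ^+ m / m`!%:R * (if j == k then b else 1) ^+ m)
  (fun j => expR (((if j == k then b else 1) - 1) * th j))).
- rewrite (bigD1 k)//= eqxx big1 ?mulr1// => j /negPf ->.
  by rewrite subrr mul0r expR0.
- move=> j m; rewrite !mulr_ge0 ?expR_ge0 ?exprn_ge0//; by case: ifP.
- by move=> j; rewrite esum_poisson_gen//; case: ifP.
Qed.

Lemma esum_poi_lik1 th : (forall j, 0 <= th j) ->
  (\esum_(x in [set: pt d]) (poi_lik x th)%:E = 1)%E.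
Proof.
move=> th0; rewrite (@esum_prod_ffun R nat d
  (fun j m => expR (- th j) * th j ^+ m / m`!%:R) (fun=> 1)).
- by rewrite big1_eq.
- by move=> j m; rewrite !mulr_ge0 ?expR_ge0 ?exprn_ge0.
- move=> j; have := esum_poisson_gen (th0 j) (@ler01 R).
  rewrite subrr mul0r expR0 => <-.
  by apply: eq_esum => m _; rewrite expr1n mulr1.
Qed.

Lemma poi_lik_le1 x th : (forall j, 0 <= th j) -> poi_lik x th <= 1.
Proof.
move=> th0; rewrite -lee_fin -(esum_poi_lik1 th0); apply: esum_ge.
exists [set x]; last by rewrite fsbig_set1.
by split=> //; exact: finite_set1.
Qed.

(** Cancelling one factor of the factorial trades a shift of the observation for a factor [th j];
    the closed form of the Bayes estimator and of the posterior moments rests on it. *)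
Lemma poi_lik_incr j x th :
  (x j).+1%:R * poi_lik (incr j x) th = th j * poi_lik x th.
Proof.
rewrite /poi_lik (bigD1 j)//= [in RHS](bigD1 j)//= !ffunE eqxx.
rewrite (eq_bigr (fun k => expR (- th k) * th k ^+ x k / (x k)`!%:R)); last first.
  by move=> k /negPf kj; rewrite ffunE kj.
rewrite !mulrA; congr (_ * _); rewrite factS natrM exprS.
have f0 : (x j)`!%:R != 0 :> R by rewrite pnatr_eq0 -lt0n fact_gt0.
have s0 : (x j).+1%:R != 0 :> R by rewrite pnatr_eq0.
by field; rewrite f0 addrC natr1.
Qed.

End PoissonLikelihood.

(** * Integrals of nonnegative real functions *)

Section RealIntegral.
Variables (R : realType) (d : measure_display) (T : measurableType d)
  (mu : measure T R).
Implicit Types (f g : T -> R) (c : R).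

Lemma integral_EFinD f g : measurable_fun [set: T] f ->
  measurable_fun [set: T] g -> (forall t, 0 <= f t) -> (forall t, 0 <= g t) ->
  (\int[mu]_t (f t + g t)%:E = \int[mu]_t (f t)%:E + \int[mu]_t (g t)%:E)%E.
Proof.
move=> mf mg f0 g0; rewrite -ge0_integralD//.
- by move=> t _; rewrite lee_fin.
- exact/measurable_EFinP.
- by move=> t _; rewrite lee_fin.
- exact/measurable_EFinP.
Qed.

Lemma integral_EFinZ f c : measurable_fun [set: T] f ->
  (forall t, 0 <= f t) -> 0 <= c ->
  (\int[mu]_t (c * f t)%:E = c%:E * \int[mu]_t (f t)%:E)%E.
Proof.
move=> mf f0 c0; rewrite -ge0_integralZl_EFin//.
- by move=> t _; rewrite lee_fin.
- exact/measurable_EFinP.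
Qed.

Lemma le_integral_EFin f g : measurable_fun [set: T] f ->
  measurable_fun [set: T] g -> (forall t, 0 <= f t) -> (forall t, f t <= g t) ->
  (\int[mu]_t (f t)%:E <= \int[mu]_t (g t)%:E)%E.
Proof.
move=> mf mg f0 fg; apply: ge0_le_integral => //.
- by move=> t _; rewrite lee_fin.
- exact/measurable_EFinP.
- exact/measurable_EFinP.
- by move=> t _; rewrite lee_fin.
Qed.

End RealIntegral.

Lemma integral1_probability (R : realType) (d : measure_display)
  (T : measurableType d) (P : probability T R) : (\int[P]_t 1%:E = 1)%E.
Proof. by rewrite integral_cst// mul1e; exact: probability_setT. Qed.

(** * The mixture pmf, posterior moments and the Bayes estimator *)

Section Mixture.
Variables (R : realType) (d : nat) (d0 : measure_display) (T : measurableType d0)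
  (P : probability T R) (theta : 'I_d -> T -> R).
Hypothesis mtheta : forall j, measurable_fun [set: T] (theta j).
Hypothesis theta0 : forall j t, 0 <= theta j t.
Implicit Types (x : pt d) (j k : 'I_d).
Local Notation lik x t := (poi_lik x (fun j => theta j t)).
Local Notation p := (Defs.pmf P theta).
Local Notation fstar := (bayes P theta).

Lemma mixture_lik_ge0 x t : 0 <= lik x t.
Proof. exact: poi_lik_ge0. Qed.
Local Hint Resolve mixture_lik_ge0 : core.

Lemma measurable_mixture_lik x : measurable_fun [set: T] (fun t => lik x t).
Proof.
apply: measurable_prod => j _; apply: measurable_funM => //.
apply: measurable_funM; last exact: measurable_funX.
by apply: measurableT_comp => //; exact: measurableT_comp.
Qed.
Local Hint Resolve measurable_mixture_lik : core.

Lemma integral_lik x : (\int[P]_t (lik x t)%:E = (p x)%:E)%E.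
Proof.
rewrite /Defs.pmf fineK// ge0_fin_numE; last first.
  by apply: integral_ge0 => t _; rewrite lee_fin.
apply: (@le_lt_trans _ _ (\int[P]_t 1%:E)%E).
  by apply: le_integral_EFin => // t; exact: poi_lik_le1.
by rewrite integral1_probability ltry.
Qed.

Lemma mixture_pmf_ge0 x : 0 <= p x.
Proof.
by rewrite -lee_fin -integral_lik; apply: integral_ge0 => t _; rewrite lee_fin.
Qed.
Local Hint Resolve mixture_pmf_ge0 : core.

(** Reduces tail bounds for an observed coordinate to exponential moments of the prior. *)
Lemma expect_pow_coord k (b : R) : 0 <= b ->
  (expect p (fun x => b ^+ x k)%R = \int[P]_t (expR ((b - 1) * theta k t))%:E)%E.
Proof.
move=> b0; rewrite /expect.
under eq_esum => x _ do rewrite mulrC EFinM -integral_lik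
  -integral_EFinZ ?exprn_ge0//.
rewrite -integral_esum; first last.
- by move=> x t; rewrite lee_fin mulr_ge0// exprn_ge0.
- by move=> x; apply/measurable_EFinP/measurable_funM.
apply: eq_integral => t _; rewrite -(@esum_poi_lik R d k (fun j => theta j t))//.
by apply: eq_esum => x _; rewrite mulrC.
Qed.

Lemma mixture_pmf_sum1 : expect p (fun=> 1) = 1%E.
Proof.
rewrite /expect; under eq_esum => x _ do rewrite mulr1 -integral_lik.
rewrite -integral_esum; first last.
- by move=> x t; rewrite lee_fin.
- by move=> x; apply/measurable_EFinP.
under eq_integral => t _ do rewrite esum_poi_lik1//.
exact: integral1_probability.
Qed.

(** The unnormalised posterior moments [E[theta_j; X = x]] and [E[theta_j ^ 2; X = x]], expressed by
    shifted pmf values so that they are real numbers from the outset. *)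
Definition moment1 x j : R := (x j).+1%:R * p (incr j x).
Definition moment2 x j : R := (x j).+1%:R * moment1 (incr j x) j.

Lemma integral_moment1 x j :
  (\int[P]_t (theta j t * lik x t)%:E = (moment1 x j)%:E)%E.
Proof.
under eq_integral => t _ do rewrite -poi_lik_incr.
by rewrite integral_EFinZ// integral_lik.
Qed.

Lemma integral_moment2 x j :
  (\int[P]_t (theta j t * (theta j t * lik x t))%:E = (moment2 x j)%:E)%E.
Proof.
under eq_integral => t _ do rewrite -poi_lik_incr mulrCA.
rewrite integral_EFinZ//; first by rewrite integral_moment1.
- exact: measurable_funM.
- by move=> t; exact: mulr_ge0.
Qed.

Lemma integral_sq x j a : 0 <= a ->
  (\int[P]_t (lik x t * (a - theta j t) ^+ 2)%:E =
   (a ^+ 2 * p x - 2 * a * moment1 x j + moment2 x j)%:E)%E.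
Proof.
move=> a0.
have m1 : measurable_fun [set: T] (fun t => theta j t * lik x t).
  exact: measurable_funM.
have m2 : measurable_fun [set: T] (fun t => theta j t * (theta j t * lik x t)).
  exact: measurable_funM.
have ms : measurable_fun [set: T] (fun t => lik x t * (a - theta j t) ^+ 2).
  by apply: measurable_funM => //; apply: measurable_funX; exact: measurable_funB.
have p1 t : 0 <= theta j t * lik x t by exact: mulr_ge0.
have p2 t : 0 <= theta j t * (theta j t * lik x t) by exact: mulr_ge0.
have ps t : 0 <= lik x t * (a - theta j t) ^+ 2 by rewrite mulr_ge0// sqr_ge0.
have m1a : measurable_fun [set: T] (fun t => 2 * a * (theta j t * lik x t)).
  exact: measurable_funM.
have p1a t : 0 <= 2 * a * (theta j t * lik x t) by rewrite !mulr_ge0.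
have ml : measurable_fun [set: T] (fun t => a ^+ 2 * lik x t).
  exact: measurable_funM.
have pl t : 0 <= a ^+ 2 * lik x t by rewrite mulr_ge0// sqr_ge0.
(* The cross term is carried to the left, so that every integrand is nonnegative. *)
have : (\int[P]_t (lik x t * (a - theta j t) ^+ 2)%:E +
    \int[P]_t (2 * a * (theta j t * lik x t))%:E =
    \int[P]_t (a ^+ 2 * lik x t)%:E +
    \int[P]_t (theta j t * (theta j t * lik x t))%:E)%E.
  rewrite -(integral_EFinD _ ms m1a ps p1a) -(integral_EFinD _ ml m2 pl p2).
  by apply: eq_integral => t _; congr EFin; ring.
rewrite !integral_EFinZ ?sqr_ge0 ?mulr_ge0//.
rewrite integral_moment1 integral_moment2 integral_lik.
have : (0 <= \int[P]_t (lik x t * (a - theta j t) ^+ 2)%:E)%E.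
  by apply: integral_ge0 => t _; rewrite lee_fin.
case: (\int[P]_t _)%E => // e _; rewrite -!EFinM -!EFinD => -[eE].
by congr EFin; rewrite -addrA [- _ + _]addrC addrA -eE addrK.
Qed.

(** A division-free form of Cauchy-Schwarz for the posterior: the quadratic of [integral_sq] is
    nonnegative. *)
Lemma moment_ineq x j a : 0 <= a ->
  2 * a * moment1 x j <= a ^+ 2 * p x + moment2 x j.
Proof.
move=> a0; have : (0 <= \int[P]_t (lik x t * (a - theta j t) ^+ 2)%:E)%E.
  by apply: integral_ge0 => t _; rewrite lee_fin mulr_ge0// sqr_ge0.
rewrite integral_sq// lee_fin; lra.
Qed.

Lemma moment1_ge0 x j : 0 <= moment1 x j. Proof. by rewrite mulr_ge0. Qed.
Lemma moment2_ge0 x j : 0 <= moment2 x j. Proof. by rewrite mulr_ge0// moment1_ge0. Qed.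

Lemma moment1_eq0 x j : p x = 0 -> moment1 x j = 0.
Proof.
move=> px0; apply/eqP; rewrite eq_le moment1_ge0 andbT leNgt; apply/negP => m0.
have m2 := moment2_ge0 x j.
(* At [p x = 0] the quadratic inequality reads [2 a moment1 <= moment2], which fails for this [a] if
   [moment1 > 0]. *)
have a0 : 0 <= moment2 x j / moment1 x j + 1.
  by rewrite addr_ge0// divr_ge0// ltW.
have a1 : (moment2 x j / moment1 x j + 1) * moment1 x j = moment2 x j + moment1 x j.
  by rewrite mulrDl mul1r mulfVK ?gt_eqF.
by have := moment_ineq x j a0; rewrite px0 mulr0 add0r -mulrA a1; lra.
Qed.

Lemma bayes_ge0 x j : 0 <= fstar x j.
Proof. by rewrite /bayes divr_ge0// mulr_ge0. Qed.

(** Where [p x = 0] the estimator is 0 by the convention on division, and the identity persists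
    because [moment1] vanishes there. *)
Lemma bayesE x j : fstar x j * p x = moment1 x j.
Proof.
rewrite /bayes; have [px0|px0] := eqVneq (p x) 0.
  by rewrite px0 mulr0 moment1_eq0.
by rewrite mulfVK.
Qed.

(** The posterior variance is nonnegative: [moment_ineq] at [a = fstar x j] gives
    [fstar x j * moment1 x j <= moment2 x j], and [moment2 x j] is
    [fstar (incr j x) j * moment1 x j]. This puts the Bayes estimator in the monotone class. *)
Lemma le_bayes_incr x j : fstar x j <= fstar (incr j x) j.
Proof.
have [p'0|p'0] := eqVneq (p (incr j x)) 0.
  rewrite (_ : fstar x j = 0) ?bayes_ge0//.
  by rewrite /bayes p'0 mulr0 mul0r.
have pp : 0 < p (incr j x) by rewrite lt_def p'0 mixture_pmf_ge0.
have u0 : 0 < (x j).+1%:R * p (incr j x) by rewrite mulr_gt0.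
have H := moment_ineq x j (bayes_ge0 x j); have E := bayesE x j.
have E' := bayesE (incr j x) j.
rewrite /moment2 -E' in H; rewrite /moment1 in E, H.
rewrite -(ler_pM2r u0).
have E2 : fstar x j ^+ 2 * p x = fstar x j * ((x j).+1%:R * p (incr j x)).
  by rewrite -E; ring.
by rewrite E2 in H; lra.
Qed.

Lemma ae_bounded h : P [set t | forall j, theta j t <= h] = 1%E ->
  \forall t \ae P, forall j, theta j t <= h.
Proof.
move=> Ph.
have mA : measurable [set t | forall j, theta j t <= h].
  rewrite (_ : [set t | _] = \bigcap_(j in [set: 'I_d]) [set t | theta j t <= h]).
    apply: fin_bigcap_measurable => [|k _]; first exact: finite_finset.
    rewrite -[X in measurable X]setTI; exact: measurable_fun_le.
  by apply/seteqP; split=> t /= H k; [move=> _|]; exact: H.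
apply/negligibleP; last first.
  by have := @probability_setC _ _ _ P _ mA; rewrite Ph subee// => ->.
exact: measurableC.
Qed.

Lemma support_bound_ge0 h j :
  P [set t | forall j, theta j t <= h] = 1%E -> 0 <= h.
Proof.
move=> Ph; rewrite leNgt; apply/negP => h0; move: Ph.
rewrite (_ : [set t | _] = set0) ?measure0 => [/eqP|].
  by rewrite eq_sym onee_eq0.
apply/seteqP; split=> // t /= /(_ j); have := theta0 j t; lra.
Qed.

Lemma bayes_le h x j : P [set t | forall j, theta j t <= h] = 1%E -> fstar x j <= h.
Proof.
move=> Ph; have aeh := ae_bounded Ph; have h0 := support_bound_ge0 j Ph.
have [px0|px0] := eqVneq (p x) 0; first by rewrite /bayes px0 invr0 mulr0.
have pp : 0 < p x by rewrite lt_def px0 mixture_pmf_ge0.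
rewrite -(ler_pM2r pp) bayesE -lee_fin.
rewrite -integral_moment1 EFinM -integral_lik -integral_EFinZ//.
apply: ae_ge0_le_integral => //.
- by move=> t _; rewrite lee_fin mulr_ge0.
- by apply/measurable_EFinP/measurable_funM.
- by move=> t _; rewrite lee_fin mulr_ge0.
- by apply/measurable_EFinP/measurable_funM.
- by apply: filterS aeh => t H _; rewrite lee_fin ler_wpM2r.
Qed.

(** Conditional Jensen, cell by cell: the exponential lies above its tangent at [c * fstar x j], and
    the linear term integrates to zero because [fstar x j] is the posterior mean. *)
Lemma expect_expR_bayes (c : R) j : 0 <= c ->
  (expect p (fun x => expR (c * fstar x j))%R <=
   \int[P]_t (expR (c * theta j t))%:E)%E.
Proof.
move=> c0.
have me : measurable_fun [set: T] (fun t => expR (c * theta j t)).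
  by apply: measurableT_comp => //; exact: measurable_funM.
have mle x : measurable_fun [set: T] (fun t => lik x t * expR (c * theta j t)).
  exact: measurable_funM.
have -> : (\int[P]_t (expR (c * theta j t))%:E =
    \esum_(x in [set: pt d]) \int[P]_t (lik x t * expR (c * theta j t))%:E)%E.
  rewrite -integral_esum; first last.
  - by move=> x t; rewrite lee_fin mulr_ge0// expR_ge0.
  - by move=> x; apply/measurable_EFinP.
  apply: eq_integral => t _.
  under eq_esum => x _ do rewrite mulrC EFinM.
  rewrite esumZl ?expR_ge0//; last by move=> x; rewrite lee_fin.
  by rewrite esum_poi_lik1// mule1.
rewrite /expect; apply: le_esum => x _.
set f := fstar x j; have f0 : 0 <= f := bayes_ge0 x j.
set E := expR (c * f); have E0 : 0 <= E by exact: expR_ge0.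
have m1 : measurable_fun [set: T] (fun t => theta j t * lik x t).
  exact: measurable_funM.
have cf0 : 0 <= c * f * E by do 2 (apply: mulr_ge0 => //).
have cE0 : 0 <= c * E by rewrite mulr_ge0.
have ml : measurable_fun [set: T] (fun t => E * lik x t).
  exact: measurable_funM.
have pl t : 0 <= E * lik x t by rewrite mulr_ge0.
have m1a : measurable_fun [set: T] (fun t => c * E * (theta j t * lik x t)).
  exact: measurable_funM.
have p1a t : 0 <= c * E * (theta j t * lik x t) by rewrite !mulr_ge0.
have mr : measurable_fun [set: T] (fun t => c * f * E * lik x t).
  exact: measurable_funM.
have pr t : 0 <= c * f * E * lik x t by rewrite mulr_ge0.
have pe t : 0 <= lik x t * expR (c * theta j t) by rewrite mulr_ge0// expR_ge0.
have : (\int[P]_t (E * lik x t)%:E + \int[P]_t (c * E * (theta j t * lik x t))%:E <=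
    \int[P]_t (lik x t * expR (c * theta j t))%:E +
    \int[P]_t (c * f * E * lik x t)%:E)%E.
  rewrite -(integral_EFinD _ ml m1a pl p1a) -(integral_EFinD _ (mle x) mr pe pr).
  apply: le_integral_EFin.
  - exact: measurable_funD.
  - exact: measurable_funD.
  - by move=> t; rewrite addr_ge0.
  - move=> t; have /ler_wpM2l := expR_ge1Dx (c * theta j t - c * f).
    move=> /(_ (lik x t * E)); rewrite mulr_ge0// => /(_ isT).
    rewrite -[_ * E * expR _]mulrA -expRD [c * f + _]addrC subrK; lra.
rewrite !integral_EFinZ//; last by move=> t; exact: mulr_ge0.
rewrite integral_moment1 integral_lik -bayesE -/f -!EFinM.
rewrite (_ : c * E * (f * p x) = c * f * E * p x); last by ring.
rewrite leeD2rE// mulrC//.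
Qed.

End Mixture.

(** * Excess risk *)

Section Regret.
Variables (R : realType) (d : nat) (d0 : measure_display) (T : measurableType d0)
  (P : probability T R) (theta : 'I_d -> T -> R).
Hypothesis mtheta : forall j, measurable_fun [set: T] (theta j).
Hypothesis theta0 : forall j t, 0 <= theta j t.
Local Notation lik x t := (poi_lik x (fun j => theta j t)).
Local Notation p := (Defs.pmf P theta).
Local Notation fstar := (bayes P theta).

Lemma riskE (f : estimator R d) : (forall x j, 0 <= f x j) ->
  (risk P theta f = \esum_(x in [set: pt d])
    (\sum_j (f x j ^+ 2 * p x - 2 * f x j * moment1 P theta x j +
             moment2 P theta x j))%:E)%E.
Proof.
move=> f0; rewrite /risk.
have mcell x j : measurable_fun [set: T]
    (fun t => lik x t * (f x j - theta j t) ^+ 2).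
  apply: measurable_funM; first exact: measurable_mixture_lik.
  by apply: measurable_funX; exact: measurable_funB.
have cell0 x j t : 0 <= lik x t * (f x j - theta j t) ^+ 2.
  by rewrite mulr_ge0 ?sqr_ge0// mixture_lik_ge0.
transitivity (\esum_(x in [set: pt d]) (\int[P]_t
    (\sum_j (lik x t * (f x j - theta j t) ^+ 2)%:E)))%E.
  rewrite -integral_esum.
  - apply: eq_integral => t _; apply: eq_esum => x _.
    by rewrite mulr_sumr -sumEFin.
  - by move=> x; apply: emeasurable_sum => j; exact/measurable_EFinP.
  - by move=> x t; apply: sume_ge0 => j _; rewrite lee_fin.
apply: eq_esum => x _; rewrite ge0_integral_sum//; first last.
- by move=> j t _; rewrite lee_fin.
- by move=> j; exact/measurable_EFinP.
by rewrite -sumEFin; apply: eq_bigr => j _; rewrite integral_sq.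
Qed.

(** Pythagoras in each cell: with [moment1 = fstar * p], the difference of the two quadratics is a
    square. *)
Lemma risk_excess (f : estimator R d) : (forall x j, 0 <= f x j) ->
  (risk P theta f = risk P theta fstar +
    expect p (fun x => \sum_j (f x j - fstar x j) ^+ 2)%R)%E.
Proof.
move=> f0; rewrite !riskE//; last by move=> x j; exact: bayes_ge0.
rewrite /expect -esumD.
- apply: eq_esum => x _; rewrite -EFinD mulr_sumr -big_split /=; congr EFin.
  apply: eq_bigr => j _; rewrite -(bayesE P mtheta theta0 x j); ring.
- move=> x _; rewrite lee_fin; apply: sumr_ge0 => j _.
  rewrite -lee_fin -integral_sq ?bayes_ge0//.
  apply: integral_ge0 => t _.
  by rewrite lee_fin mulr_ge0 ?sqr_ge0// mixture_lik_ge0.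
- move=> x _; rewrite lee_fin mulr_ge0 ?mixture_pmf_ge0//.
  by apply: sumr_ge0 => j _; exact: sqr_ge0.
Qed.

Lemma regret_le n (fhat : sample d n -> estimator R d) (D : sample d n -> R) c :
  (forall s x j, 0 <= fhat s x j) ->
  (forall s, (expect p (fun x => \sum_j (fhat s x j - fstar x j) ^+ 2)%R <=
    (D s)%:E)%E) ->
  (expect (iid_weight p) D <= c%:E)%E ->
  (regret P theta fhat <= c%:E)%E.
Proof.
move=> f0 fD Dc; rewrite /regret.
have p0 x : 0 <= p x by exact: mixture_pmf_ge0.
have W0 (s : sample d n) : 0 <= iid_weight p s by exact: iid_weight_ge0.
have D0 s : 0 <= D s.
  rewrite -lee_fin; apply: le_trans (fD s).
  by apply: expect_ge0 => // x; apply: sumr_ge0 => j _; exact: sqr_ge0.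
have r0 : (0 <= risk P theta fstar)%E.
  apply: integral_ge0 => t _; apply: esum_ge0 => x _.
  rewrite lee_fin mulr_ge0 ?mixture_lik_ge0//.
  by apply: sumr_ge0 => j _; exact: sqr_ge0.
have := risk_excess (f0 _).
(* If the Bayes risk is infinite, the extended difference is [-oo] and the bound is trivial. *)
case: (risk P theta fstar) r0 => [r|_ _|//]; last by rewrite addeNy leNye.
rewrite lee_fin => r0 exc; rewrite leeBlDr//.
apply: (@le_trans _ _ (expect (iid_weight p) (fun s => D s + r))).
  apply: le_esum => s _; rewrite exc EFinM lee_wpmul2l ?lee_fin ?prodr_ge0//.
  by rewrite EFinD addeC; apply: leeD => //; exact: fD.
rewrite expectD// leeD// expect_iid_cst//; exact: mixture_pmf_sum1.
Qed.

End Regret.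

(** * The ERM *)

Section PoissonErm.
Variables (R : realType) (d n : nat) (s : sample d n).
Implicit Types (f : estimator R d) (g : pt d -> R) (x : pt d) (j k : 'I_d).

Lemma incr_subj1 j x : (0 < x j)%N -> incr j (subj j 1 x) = x.
Proof.
move=> xj; apply/ffunP => k; rewrite !ffunE; case: eqP => [->|//].
by rewrite subn1 prednK.
Qed.

Lemma subj1_incr j x : subj j 1 (incr j x) = x.
Proof.
by apply/ffunP => k; rewrite !ffunE; case: eqP => [->|//]; rewrite subn1.
Qed.

(** The share of coordinate [j] in the objective, without the factor [1 / n]. When [s i j = 0],
    [subj] truncates to [s i] itself, but the weight is zero. *)
Definition coord_obj j g : R :=
  \sum_i (g (s i) ^+ 2 - 2 * (s i j)%:R * g (subj j 1 (s i))).

Lemma emp_objE f : emp_obj s f = n%:R^-1 * \sum_j coord_obj j (f ^~ j).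
Proof.
rewrite /emp_obj /coord_obj exchange_big /=; congr (_ * _).
apply: eq_bigr => i _; rewrite mulr_sumr -sumrB.
by apply: eq_bigr => j _; rewrite mulrA.
Qed.

(** Objective and constraints both separate over coordinates, so changing only coordinate [j] to [g]
    gives an admissible competitor. *)
Lemma erm_coord_le f j g : is_erm s f ->
  (forall x, 0 <= g x) -> (forall x, g x <= g (incr j x)) ->
  coord_obj j (f ^~ j) <= coord_obj j g.
Proof.
move=> [fF [fmin _]] g0 gmon; have [n0|n0] := posnP n.
  by rewrite /coord_obj !big1// => i _; have := ltn_ord i; rewrite [X in (_ < X)%N]n0.
pose h : estimator R d := fun x k => if k == j then g x else f x k.
have /fmin : in_F h.
  move=> x k; rewrite /h; case: eqP => [->|_]; first by [].
  exact: fF.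
rewrite !emp_objE ler_pM2l ?invr_gt0 ?ltr0n//.
rewrite (bigD1 j)//= [leRHS](bigD1 j)//=.
rewrite {1}[X in _ <= X + _](_ : _ = coord_obj j g); last first.
  by apply: eq_bigr => i _; rewrite /h eqxx.
rewrite [X in _ <= _ + X](_ : _ = \sum_(k | k != j) coord_obj k (f ^~ k)).
  by rewrite lerD2r.
apply: eq_bigr => k /negPf kj; apply: eq_bigr => i _.
by rewrite /h kj.
Qed.

(* Truncating [f] at [m] cannot increase the objective: the excess [phi] of [f]
   over [m] is monotone, so [x_j * phi (x - e_j) <= m * phi x] at sample points. *)
Lemma erm_le_max f j m : is_erm s f -> (forall i, (s i j <= m)%N) ->
  forall x, f x j <= m%:R.
Proof.
move=> erm sm; have [fF [_ fext]] := erm.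
have f0 x : 0 <= f x j by have [] := fF x j.
have fmon x : f x j <= f (incr j x) j by have [] := fF x j.
pose g x := Num.min (f x j) m%:R.
have g0 x : 0 <= g x by rewrite le_min f0 ler0n.
have gmon x : g x <= g (incr j x).
  by rewrite le_min !ge_min fmon lexx orbT.
pose phi x := f x j - g x.
have phi0 x : 0 <= phi x by rewrite subr_ge0 ge_min lexx.
have phim x : phi x * g x = phi x * m%:R.
  by rewrite /phi /g; case: leP => // _; rewrite subrr !mul0r.
have phimon x : phi x <= phi (incr j x).
  have fx := fmon x; rewrite /phi /g minEle [X in _ <= _ - X]minEle.
  by case: ifPn; case: ifPn; rewrite -?ltNge => *; lra.
have obj := erm_coord_le erm g0 gmon.
(* Truncation would lower the objective by at least the sum of [phi (s i) ^+ 2], so minimality makes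
   each of these squares zero. *)
have phis i : phi (s i) = 0.
  have : \sum_i phi (s i) ^+ 2 <= 0.
    suff: \sum_i phi (s i) ^+ 2 + coord_obj j g <= coord_obj j g by rewrite gerDr.
    apply: (le_trans _ obj); rewrite /coord_obj -big_split /=.
    apply: ler_sum => k _.
    have fE x : f x j = g x + phi x by rewrite addrC subrK.
    rewrite !fE; have := phim (s k).
    have : (s k j)%:R * phi (subj j 1 (s k)) <= m%:R * phi (s k).
      have [->|sk] := posnP (s k j); first by rewrite mul0r mulr_ge0.
      apply: ler_pM => //; first by rewrite ler_nat.
      by rewrite -{2}(incr_subj1 sk).
    set X := (s k j)%:R; set u := phi (s k); set v := phi (subj _ _ _).
    set a := g (s k); set b := g (subj _ _ _) => H1 H2.
    have -> : (a + u) ^+ 2 = a ^+ 2 + 2 * (u * a) + u ^+ 2 by ring.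
    rewrite H2; lra.
  move=> sum0; have /eqP : \sum_i phi (s i) ^+ 2 = 0.
    by apply/eqP; rewrite eq_le sum0 sumr_ge0// => l _; exact: sqr_ge0.
  rewrite psumr_eq0 => [/allP/(_ i)|l _]; last exact: sqr_ge0.
  by rewrite mem_index_enum sqrf_eq0 => /(_ isT)/eqP.
have fs i : f (s i) j <= m%:R.
  have /eqP := phis i; rewrite subr_eq0 => /eqP ->.
  by rewrite ge_min lexx orbT.
have fS x : Sj s j x -> f x j <= m%:R.
  move=> [i [->//|[si ->]]]; apply: le_trans (fmon _) _.
  by rewrite incr_subj1.
(* Off [S_j] the value is either 0 or copied from the closest point of [S_j] below in direction [j],
   hence inherits the bound. *)
move=> x; have [/fS//|xS] := pselect (Sj s j x).
have [fnone fsome] := fext j x xS.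
have [[y Py]|none] := pselect (exists y, (y <= x j)%N /\ Sj s j (subj j y x)).
  have ex : exists y, (y <= x j)%N && `[< Sj s j (subj j y x) >].
    by exists y; case: Py => -> /asboolP.
  case: (ex_minnP ex) => z /andP[zx /asboolP zS] zmin.
  rewrite (fsome z)//; first exact: fS.
  move=> y' y'z y'S; have := zmin y'; rewrite (leq_trans (ltnW y'z) zx)/=.
  by move=> /(_ (introT (asboolP _) y'S)); rewrite leqNgt y'z.
by rewrite fnone// => y yx yS; apply: none; exists y.
Qed.

(** Insert [(f - g) ^ 2 = f ^ 2 - g ^ 2 + 2 g (g - f)] into the comparison of the two objectives. *)
Lemma erm_basic_ineq f j g : is_erm s f ->
  (forall x, 0 <= g x) -> (forall x, g x <= g (incr j x)) ->
  \sum_i (f (s i) j - g (s i)) ^+ 2 <=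
  2 * \sum_i (g (s i) * (g (s i) - f (s i) j) -
    (s i j)%:R * (g (subj j 1 (s i)) - f (subj j 1 (s i)) j)).
Proof.
move=> erm g0 gmon; have := erm_coord_le erm g0 gmon.
rewrite -subr_ge0 /coord_obj -sumrB => obj.
rewrite -subr_ge0 mulr_sumr -sumrB.
by apply: le_trans obj _; apply: ler_sum => i _; lra.
Qed.

(** * Sample sums as sums over the cells of a finite cube *)

Section Cells.
Variable M : nat.

Definition cell_pt (c : {ffun 'I_d -> 'I_M}) : pt d := [ffun k => val (c k)].

Lemma cell_pt_inj : injective cell_pt.
Proof.
move=> c c' /ffunP cc; apply/ffunP => k; apply: val_inj.
by have := cc k; rewrite !ffunE.
Qed.

Lemma cell_pt_lt c k : (cell_pt c k < M)%N.
Proof. by rewrite ffunE; exact: ltn_ord. Qed.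

Lemma cell_pt_onto x : (forall k, (x k < M)%N) -> exists c, cell_pt c = x.
Proof.
move=> xM; exists [ffun k => Ordinal (xM k)].
by apply/ffunP => k; rewrite !ffunE.
Qed.

Lemma sum_cell_pt_delta (F : pt d -> R) (y : pt d) : (forall k, (y k < M)%N) ->
  \sum_c (y == cell_pt c)%:R * F (cell_pt c) = F y.
Proof.
move=> /cell_pt_onto[c0 <-]; rewrite (bigD1 c0)//= eqxx mul1r big1 ?addr0//.
by move=> c cc0; rewrite (inj_eq cell_pt_inj) eq_sym (negPf cc0) mul0r.
Qed.

Lemma sum_sample_cells (F : pt d -> R) : (forall i k, (s i k < M)%N) ->
  \sum_i F (s i) = \sum_c count_occ R s (cell_pt c) * F (cell_pt c).
Proof.
move=> sM; under [RHS]eq_bigr => c _ do rewrite mulr_suml.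
by rewrite exchange_big; apply: eq_bigr => i _; rewrite sum_cell_pt_delta.
Qed.

(** Index by the shifted point [x = X_i - e_j]: then [X_ij = x_j + 1], and the count is taken at
    [x + e_j]. Points with [X_ij = 0] disappear from both sides, since [x + e_j] has a positive
    [j]-th entry. *)
Lemma sum_sample_cells_incr j (F : pt d -> R) : (forall i k, (s i k < M)%N) ->
  \sum_i (s i j)%:R * F (subj j 1 (s i)) =
  \sum_c (cell_pt c j).+1%:R * count_occ R s (incr j (cell_pt c)) * F (cell_pt c).
Proof.
move=> sM.
under [RHS]eq_bigr => c _ do rewrite mulr_sumr mulr_suml.
rewrite exchange_big; apply: eq_bigr => i _ /=.
have [si|si] := posnP (s i j).
  rewrite si mul0r big1// => c _; case: eqP => [E|_]; last by rewrite mulr0 mul0r.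
  by have := si; rewrite E ffunE eqxx.
have -> : (s i j)%:R = (subj j 1 (s i) j).+1%:R :> R.
  by rewrite ffunE eqxx subn1 prednK.
rewrite -(@sum_cell_pt_delta (fun x => (x j).+1%:R * F x) (subj j 1 (s i))).
  apply: eq_bigr => c _; rewrite (_ : (s i == _) = (subj j 1 (s i) == cell_pt c)).
    by ring.
  by apply/eqP/eqP => [->|<-]; rewrite ?subj1_incr ?incr_subj1.
by move=> k; rewrite ffunE; case: ifP => // _; rewrite (leq_ltn_trans (leq_subr _ _)).
Qed.

End Cells.
End PoissonErm.

(** * Cell-by-cell analysis of one coordinate *)

Section CoordinateRegret.
Variables (R : realType) (d n M : nat) (j : 'I_d) (p fs : pt d -> R) (B : R).
Hypothesis n_gt0 : (0 < n)%N.
Hypothesis p_ge0 : forall x, 0 <= p x.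
Hypothesis p_sum1 : expect p (fun=> 1) = 1%E.
Hypothesis fs_ge0 : forall x, 0 <= fs x.
Hypothesis fs_incr : forall x, fs x <= fs (incr j x).
Hypothesis fs_balance : forall x, fs x * p x = (x j).+1%:R * p (incr j x).
Hypothesis B_ge0 : 0 <= B.
Implicit Types (x : pt d) (s : sample d n) (c : {ffun 'I_d -> 'I_M}).

Local Notation K := (B + M%:R).
Local Notation cells := {ffun 'I_d -> 'I_M}.
Local Notation N := (count_occ R).

Definition good_pt x := (0 < p x) && (fs x <= B).

(** On a good cell, the AM-GM cost with weight [n p x], plus a penalty when the cell is
    under-occupied; [K] dominates the distance between the ERM and the truncated Bayes estimator. On
    the other cells, a crude bound on the right-hand side of the basic inequality. *)
Definition cell_error s x : R :=
  if good_pt x then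
    64 * ((n%:R * p x)^-1 * (fs x * N s x - (x j).+1%:R * N s (incr j x)) ^+ 2) +
    2 * K ^+ 2 * (n%:R * p x * (N s x < n%:R * p x / 4)%R%:R)
  else 16 * K * (B * N s x + (x j).+1%:R * N s (incr j x)).

Let K_ge0 : 0 <= K. Proof. by rewrite addr_ge0. Qed.
Let n_gt0R : 0 < n%:R :> R. Proof. by rewrite ltr0n. Qed.

Lemma cell_error_ge0 s x : 0 <= cell_error s x.
Proof.
have N0 y : 0 <= N s y by exact: count_occ_ge0.
rewrite /cell_error; case: ifP => _.
  apply: addr_ge0.
    by rewrite mulr_ge0// mulr_ge0 ?sqr_ge0// invr_ge0 mulr_ge0.
  by apply: mulr_ge0; rewrite ?mulr_ge0// ?sqr_ge0// mulr_ge0.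
by apply: mulr_ge0; [rewrite mulr_ge0|rewrite addr_ge0// mulr_ge0].
Qed.

(** * Inequalities for a fixed sample *)

Section Deterministic.
Variables (s : sample d n) (f : pt d -> R).
Hypothesis f_ge0 : forall x, 0 <= f x.
Hypothesis f_le_max : forall m, (forall i, (s i j <= m)%N) -> forall x, f x <= m%:R.
Hypothesis f_basic : forall g : pt d -> R, (forall x, 0 <= g x) ->
  (forall x, g x <= g (incr j x)) ->
  \sum_i (f (s i) - g (s i)) ^+ 2 <=
  2 * \sum_i (g (s i) * (g (s i) - f (s i)) -
    (s i j)%:R * (g (subj j 1 (s i)) - f (subj j 1 (s i)))).

Lemma sum_good_cells : (forall i k, (s i k < M)%N) ->
  \sum_(c : cells) (if good_pt (cell_pt c) then
    n%:R * p (cell_pt c) * (f (cell_pt c) - fs (cell_pt c)) ^+ 2 else 0) <=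
  \sum_(c : cells) cell_error s (cell_pt c).
Proof.
move=> sM; pose g x := Num.min (fs x) B.
have g0 x : 0 <= g x by rewrite le_min fs_ge0.
have gmon x : g x <= g (incr j x) by rewrite le_min !ge_min fs_incr lexx orbT.
have gB x : g x <= B by rewrite ge_min lexx orbT.
have fM x : f x <= M%:R by apply: f_le_max => i; exact/ltnW.
have M0 : 0 <= M%:R :> R by [].
pose L x := N s x * (f x - g x) ^+ 2 - 2 * (N s x * (g x * (g x - f x)) -
  (x j).+1%:R * N s (incr j x) * (g x - f x)).
(* The basic inequality for [g], regrouped by cells. It now suffices to compare cell by cell, with
   multiplier 8 on [L]. *)
have Lle : \sum_(c : cells) L (cell_pt c) <= 0.
  have := f_basic g0 gmon; rewrite sumrB.
  rewrite (sum_sample_cells (fun x => (f x - g x) ^+ 2) sM).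
  rewrite (sum_sample_cells (fun x => g x * (g x - f x)) sM).
  rewrite (sum_sample_cells_incr j (fun x => g x - f x) sM).
  by rewrite -subr_le0 -sumrB mulr_sumr -sumrB.
apply: (@le_trans _ _ (\sum_(c : cells) (8 * L (cell_pt c) + cell_error s (cell_pt c)))).
  apply: ler_sum => c _; move: (cell_pt c) => x; rewrite /cell_error.
  have N0 y : 0 <= N s y by exact: count_occ_ge0.
  have fx0 := f_ge0 x; have fxM := fM x; have gx0 := g0 x; have gxB := gB x.
  case: ifPn => [/andP[px fsB]|_].
    have gfs : g x = fs x by apply/min_idPl.
    rewrite /L gfs in gx0 gxB *.
    set u := n%:R * p x; have u0 : 0 < u by rewrite mulr_gt0.
    set a := N s x; have a0 : 0 <= a := N0 x.
    set b := (x j).+1%:R * N s (incr j x).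
    set del := f x - fs x; set z := fs x * a - b.
    (* AM-GM with the deterministic weight [u]; it uses up one copy of [u * del ^+ 2]. *)
    have am : 0 <= 64 * (u^-1 * z ^+ 2) + 16 * (z * del) + u * del ^+ 2.
      have -> : 64 * (u^-1 * z ^+ 2) + 16 * (z * del) + u * del ^+ 2 =
          u^-1 * (8 * z + u * del) ^+ 2 by field; rewrite gt_eqF.
      by rewrite mulr_ge0 ?invr_ge0 ?sqr_ge0// ltW.
    have del2 : del ^+ 2 <= K ^+ 2.
      rewrite -subr_ge0 subr_sqr mulr_ge0//; rewrite /del; lra.
    (* If [a >= u / 4], eight copies of [a] supply two of [u]: one is spent in [am], the other is
       the bound sought. Otherwise [del ^+ 2 <= K ^+ 2] and the penalty pays. *)
    have low : 2 * (u * del ^+ 2) <= 8 * (a * del ^+ 2) +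
        2 * K ^+ 2 * (u * (a < u / 4)%R%:R).
      case: ltP => au; rewrite ?mulr1n ?mulr0n.
        have : 0 <= a * del ^+ 2 by rewrite mulr_ge0// sqr_ge0.
        have := ler_wpM2l (ltW u0) del2; lra.
      have := ler_wpM2r (sqr_ge0 del) au; lra.
    have -> : a * (fs x * (fs x - f x)) - b * (fs x - f x) = - (z * del).
      by rewrite /z /del; ring.
    lra.
  have b0 : 0 <= (x j).+1%:R * N s (incr j x) by rewrite mulr_ge0.
  set b := _ * N s (incr j x) in b0 *.
  have a0 := N0 x; set a := N s x in a0 *; rewrite /L -/a -/b.
  have q0 : 0 <= a * (f x - g x) ^+ 2 by rewrite mulr_ge0// sqr_ge0.
  have h1 : a * (g x * (g x - f x)) <= a * (B * K).
    apply: ler_wpM2l => //; apply: (@le_trans _ _ (g x * K)).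
      by apply: ler_wpM2l => //; lra.
    exact: ler_wpM2r.
  have h2 : - (b * (g x - f x)) <= b * K.
    by rewrite -mulrN; apply: ler_wpM2l => //; lra.
  lra.
rewrite big_split /= -mulr_sumr; lra.
Qed.

(** If the sample lies in the cube, then [f <= M] and only three regions matter: good cells, points
    outside the cube, and points with [fs > B]. If some sample point leaves the cube, [f] is only
    bounded by the sample maximum, and the last sum covers the loss. *)
Lemma coord_excess_le (V2 : R) :
  (expect p (fun x => fs x ^+ 2)%R <= V2%:E)%E ->
  forall V1 : R,
  (expect p (fun x => \sum_k (M <= x k)%N%:R * (M%:R ^+ 2 + B ^+ 2) +
     (B < fs x)%R%:R * (M%:R ^+ 2 + fs x ^+ 2))%R <= V1%:E)%E ->
  (expect p (fun x => (f x - fs x) ^+ 2)%R <=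
   (n%:R^-1 * (\sum_(c : cells) cell_error s (cell_pt c)) + V1 +
    \sum_i \sum_k (M <= s i k)%N%:R * ((s i k)%:R ^+ 2 + V2))%:E)%E.
Proof.
move=> fs2 V1 tail.
have V2_ge0 : 0 <= V2.
  by rewrite -lee_fin; apply: le_trans fs2; apply: expect_ge0 => // x; exact: sqr_ge0.
have V1_ge0 : 0 <= V1.
  rewrite -lee_fin; apply: le_trans tail; apply: expect_ge0 => // x.
  rewrite addr_ge0 ?mulr_ge0 ?addr_ge0 ?sqr_ge0// sumr_ge0// => k _.
  by rewrite mulr_ge0// addr_ge0// sqr_ge0.
have S_ge0 : 0 <= n%:R^-1 * (\sum_(c : cells) cell_error s (cell_pt c)).
  by rewrite mulr_ge0 ?invr_ge0 ?sumr_ge0// => c _; exact: cell_error_ge0.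
have T_ge0 i k : 0 <= (M <= s i k)%N%:R * ((s i k)%:R ^+ 2 + V2) :> R.
  by rewrite mulr_ge0// addr_ge0// sqr_ge0.
have sqle (a b m : R) : 0 <= a -> 0 <= b -> a <= m -> (a - b) ^+ 2 <= m ^+ 2 + b ^+ 2.
  move=> a0 b0 am; apply: (@le_trans _ _ (a ^+ 2 + b ^+ 2)).
    by have := mulr_ge0 a0 b0; rewrite sqrrB mulr2n; lra.
  by rewrite lerD2r lerXn2r// nnegrE (le_trans a0).
have [sM|] := pselect (forall i k, (s i k < M)%N).
  have fM x : f x <= M%:R by apply: f_le_max => i; exact/ltnW.
  pose h c := if good_pt (cell_pt c) then
    (f (cell_pt c) - fs (cell_pt c)) ^+ 2 else 0.
  have h0 c : 0 <= h c by rewrite /h; case: ifP => // _; exact: sqr_ge0.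
  apply: (@le_trans _ _ (n%:R^-1 * (\sum_(c : cells) cell_error s (cell_pt c)) + V1)%:E); last first.
    by rewrite lee_fin lerDl sumr_ge0// => i _; exact: sumr_ge0.
  apply: (@le_trans _ _ ((\sum_(c : cells) h c * p (cell_pt c)) + V1)%:E); last first.
    rewrite lee_fin lerD2r mulrC ler_pdivlMr//.
    apply: le_trans (sum_good_cells sM); rewrite mulr_suml.
    apply: ler_sum => c _; rewrite /h; case: ifP => _; last by rewrite !mul0r.
    by rewrite le_eqVlt; apply/orP; left; apply/eqP; ring.
  apply: (@le_trans _ _ (expect p (fun x => \sum_(c : cells) h c * (x == cell_pt c)%:R +
     (\sum_k (M <= x k)%N%:R * (M%:R ^+ 2 + B ^+ 2) +
     (B < fs x)%R%:R * (M%:R ^+ 2 + fs x ^+ 2)))%R)).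
    apply: le_esum => x _; rewrite lee_fin.
    have := p_ge0 x; rewrite le_eqVlt => /predU1P[<-|px]; first by rewrite !mul0r.
    rewrite ler_pM2l//.
    have hs0 : 0 <= \sum_(c : cells) h c * (x == cell_pt c)%:R.
      by apply: sumr_ge0 => c _; rewrite mulr_ge0.
    have ks0 : 0 <= \sum_k (M <= x k)%N%:R * (M%:R ^+ 2 + B ^+ 2) :> R.
      by apply: sumr_ge0 => k _; rewrite mulr_ge0// addr_ge0// sqr_ge0.
    have dsq := sqle _ _ _ (f_ge0 x) (fs_ge0 x) (fM x).
    case: ltP => fB; first by rewrite mulr1n mul1r; lra.
    rewrite mulr0n mul0r addr0.
    have [xM|] := pselect (forall k, (x k < M)%N).
      have [c xE] := cell_pt_onto xM; rewrite (bigD1 c)//= -xE eqxx mulr1.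
      rewrite /h /good_pt xE px fB/=; rewrite -!xE in ks0 *.
      rewrite -addrA lerDl addr_ge0// sumr_ge0// => e _.
      by rewrite mulr_ge0//; exact: h0.
    move=> /existsNP[k /negP]; rewrite -leqNgt => Mk.
    apply: (le_trans dsq); rewrite (bigD1 k)//= Mk mulr1n mul1r.
    have : 0 <= \sum_(k0 | k0 != k) (M <= x k0)%N%:R * (M%:R ^+ 2 + B ^+ 2) :> R.
      by apply: sumr_ge0 => l _; rewrite mulr_ge0// addr_ge0// sqr_ge0.
    have : fs x ^+ 2 <= B ^+ 2 by rewrite lerXn2r// nnegrE.
    lra.
  apply: expect_leD => //.
  - by move=> x; apply: sumr_ge0 => c _; rewrite mulr_ge0.
  - move=> x; rewrite addr_ge0 ?mulr_ge0 ?addr_ge0 ?sqr_ge0// sumr_ge0// => k _.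
    by rewrite mulr_ge0// addr_ge0// sqr_ge0.
  - apply: expect_le_sum => // [c x|c _]; first by rewrite mulr_ge0.
    by rewrite expectZ// expect_delta.
move=> /existsNP[i0 /existsNP[k0 /negP]]; rewrite -leqNgt => Mik.
pose m := \max_i s i j.
have fm x : f x <= m%:R by apply: f_le_max => i; exact: (leq_bigmax i).
(* One term of the double sum suffices: the one attaining the maximum if it reaches [M], otherwise
   the entry that left the cube, which then exceeds [m]. *)
have mle : m%:R ^+ 2 + V2 <= \sum_i \sum_k (M <= s i k)%N%:R * ((s i k)%:R ^+ 2 + V2).
  have single i k : (M <= s i k)%N -> (s i k)%:R ^+ 2 + V2 <=
      \sum_i \sum_k (M <= s i k)%N%:R * ((s i k)%:R ^+ 2 + V2) :> R.
    move=> Mk; rewrite (bigD1 i)//= (bigD1 k)//= Mk mulr1n mul1r -addrA lerDl.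
    rewrite addr_ge0 ?sumr_ge0// => l _; exact: sumr_ge0.
  have nI : (0 < #|'I_n|)%N by rewrite card_ord.
  have [i mi] := bigop.eq_bigmax (fun i : 'I_n => s i j) nI; rewrite -/m in mi.
  have [Mi|iM] := leqP M (s i j); first by rewrite mi; exact: single.
  apply: le_trans (single _ _ Mik); rewrite lerD2r lerXn2r ?nnegrE// ler_nat mi.
  exact: leq_trans (ltnW iM) Mik.
apply: (@le_trans _ _ (m%:R ^+ 2 + V2)%:E); last by rewrite lee_fin; lra.
apply: (@le_trans _ _ (expect p (fun x => m%:R ^+ 2 + fs x ^+ 2)%R)).
  by apply: le_expect => // x; exact: sqle.
apply: (@expect_leD _ _ p (fun=> m%:R ^+ 2) (fun x => fs x ^+ 2)) => //.
- by move=> x; exact: sqr_ge0.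
- by rewrite (expect_cst p_ge0 p_sum1 (sqr_ge0 (m%:R : R))).
Qed.

End Deterministic.

(** * Expectation over the sample *)

Lemma sum_cells_le_expect (F : pt d -> R) : (forall x, 0 <= F x) ->
  ((\sum_(c : cells) p (cell_pt c) * F (cell_pt c))%:E <= expect p F)%E.
Proof.
move=> F0; have g0 (c : cells) x : 0 <= F (cell_pt c) * (x == cell_pt c)%:R.
  by rewrite mulr_ge0.
apply: (@le_trans _ _ (expect p (fun x =>
    \sum_(c : cells) F (cell_pt c) * (x == cell_pt c)%:R)%R)).
  rewrite expect_sum// -sumEFin; apply: lee_sum => c _.
  by rewrite expectZ// expect_delta// mulrC EFinM.
apply: le_expect => // x.
have [xM|xM] := pselect (forall k, (x k < M)%N).
  rewrite -(sum_cell_pt_delta F xM).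
  by apply: ler_sum => c _; rewrite mulrC.
rewrite big1// => c _; case: eqP => [E|_]; last by rewrite mulr0.
by case: xM => k; rewrite E cell_pt_lt.
Qed.

(** On a good cell the second moment divided by [n p x] is [fs x (fs x + x_j + 1) <= B (B + M)],
    summed over [M ^ d] cells. On a bad cell of positive mass, the balance equation turns the error
    into [16 K n p x (B + fs x)], and [B < fs x] bounds the last factor by [2 fs x]. *)
Lemma expect_cell_error (k1 Wd : R) :
  (expect p (fun x => fs x * (B < fs x)%R%:R)%R <= k1%:E)%E ->
  \sum_(c : cells) (if good_pt (cell_pt c) then
    n%:R * p (cell_pt c) * expR (- (n%:R * p (cell_pt c) / 4)) else 0) <= Wd ->
  (expect (iid_weight p) (fun s => \sum_(c : cells) cell_error s (cell_pt c))%R <=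
   (64 * (B * K) * M%:R ^+ d + 2 * K ^+ 2 * Wd + 32 * K * n%:R * k1)%:E)%E.
Proof.
move=> tail1 low.
have W0 s : 0 <= iid_weight p s by exact: iid_weight_ge0.
have N0 y s : 0 <= N s y by exact: count_occ_ge0.
have fb0 x : 0 <= fs x * (B < fs x)%R%:R by rewrite mulr_ge0.
pose e x := (if good_pt x then 64 * (B * K) else 0) + (2 * K ^+ 2 *
  (if good_pt x then n%:R * p x * expR (- (n%:R * p x / 4)) else 0) +
  32 * K * n%:R * (p x * (fs x * (B < fs x)%R%:R))).
apply: (@le_trans _ _ (\sum_(c : cells) e (cell_pt c))%:E); last first.
  rewrite lee_fin /e big_split /= -addrA; apply: lerD.
    apply: (@le_trans _ _ (\sum_(c : cells) 64 * (B * K))).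
      apply: ler_sum => c _; case: ifP => // _.
      by rewrite mulr_ge0// mulr_ge0.
    by rewrite sumr_const card_ffun !card_ord -natrX mulr_natr.
  rewrite big_split /= -!mulr_sumr; apply: lerD.
    by rewrite ler_wpM2l// mulr_ge0// sqr_ge0.
  rewrite ler_wpM2l ?mulr_ge0// -lee_fin; apply: le_trans tail1.
  exact: sum_cells_le_expect.
apply: expect_le_sum => // [c s|c _]; first exact: cell_error_ge0.
have := cell_pt_lt c j; move: (cell_pt c) => x xM.
have fp := fs_balance x; have p0 := p_ge0 x.
rewrite /cell_error /e; case: ifPn => [/andP[px fsB]|bad].
  have u0 : 0 < n%:R * p x by rewrite mulr_gt0.
  have u0' := ltW u0.
  have bal : (expect (iid_weight p) (fun s =>
      (fs x * N s x - (x j).+1%:R * N s (incr j x)) ^+ 2)%R <=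
      (n%:R * (fs x * (fs x + (x j).+1%:R) * p x))%:E)%E.
    apply: expect_count_balance => //.
    by apply/eqP => /ffunP/(_ j); rewrite ffunE eqxx => /n_Sn.
  have sq0 s : 0 <= (fs x * N s x - (x j).+1%:R * N s (incr j x)) ^+ 2.
    exact: sqr_ge0.
  have i0 s : 0 <= (n%:R * p x)^-1 *
      (fs x * N s x - (x j).+1%:R * N s (incr j x)) ^+ 2.
    by rewrite mulr_ge0// invr_ge0.
  have l0 s : 0 <= n%:R * p x * (N s x < n%:R * p x / 4)%R%:R by rewrite mulr_ge0.
  apply: (@le_trans _ _ (64 * ((n%:R * p x)^-1 *
      (n%:R * (fs x * (fs x + (x j).+1%:R) * p x))) +
      2 * K ^+ 2 * (n%:R * p x * expR (- (n%:R * p x / 4))))%:E).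
    apply: (@expect_leD _ _ _
      (fun s => 64 * ((n%:R * p x)^-1 *
        (fs x * N s x - (x j).+1%:R * N s (incr j x)) ^+ 2))
      (fun s => 2 * K ^+ 2 * (n%:R * p x * (N s x < n%:R * p x / 4)%R%:R))) => //.
    - by move=> s; rewrite mulr_ge0.
    - by move=> s; rewrite mulr_ge0// mulr_ge0// sqr_ge0.
    - apply: expect_leZ => //; apply: expect_leZ => //.
      by rewrite invr_ge0.
    - apply: expect_leZ => //; first by rewrite mulr_ge0// sqr_ge0.
      by apply: expect_leZ => //; exact: expect_count_low.
  rewrite lee_fin; apply: lerD; last by rewrite lerDl !mulr_ge0.
  rewrite ler_wpM2l//.
  have -> : (n%:R * p x)^-1 * (n%:R * (fs x * (fs x + (x j).+1%:R) * p x)) =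
      fs x * (fs x + (x j).+1%:R).
    by rewrite (mulrC (fs x * _) (p x)) (mulrA n%:R) mulKf ?gt_eqF.
  apply: ler_pM => //; rewrite ?addr_ge0// lerD// ler_nat.
  exact: xM.
rewrite mulr0 !add0r.
apply: (@le_trans _ _ (16 * K * (B * (n%:R * p x) +
    (x j).+1%:R * (n%:R * p (incr j x))))%:E).
  apply: expect_leZ => //.
  - by move=> s; rewrite addr_ge0// mulr_ge0.
  - by rewrite mulr_ge0.
  apply: (@expect_leD _ _ _ (fun s => B * N s x)
    (fun s => (x j).+1%:R * N s (incr j x))) => //.
  - by move=> s; rewrite mulr_ge0.
  - by move=> s; rewrite mulr_ge0.
  - by apply: expect_leZ => //; rewrite expect_count.
  - by apply: expect_leZ => //; rewrite expect_count.
rewrite lee_fin [_ * (n%:R * p (incr j x))]mulrCA -fp.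
have -> : 16 * K * (B * (n%:R * p x) + n%:R * (fs x * p x)) =
    16 * K * n%:R * (p x * (B + fs x)) by ring.
have -> : 32 * K * n%:R * (p x * (fs x * (B < fs x)%R%:R)) =
    16 * K * n%:R * (p x * (2 * (fs x * (B < fs x)%R%:R))) by ring.
rewrite ler_wpM2l ?mulr_ge0//.
move: bad; rewrite /good_pt negb_and -leNgt -ltNge => /orP[pn|Bf].
  have -> : p x = 0 by apply/eqP; rewrite eq_le pn p0.
  by rewrite !mul0r.
by rewrite Bf mulr1n mulr1 ler_wpM2l//; lra.
Qed.

Lemma expect_coord_bound (k1 Wd V1 V2 t0 t2 : R) : 0 <= V1 -> 0 <= V2 ->
  (expect p (fun x => fs x * (B < fs x)%R%:R)%R <= k1%:E)%E ->
  \sum_(c : cells) (if good_pt (cell_pt c) then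
    n%:R * p (cell_pt c) * expR (- (n%:R * p (cell_pt c) / 4)) else 0) <= Wd ->
  (forall k, (expect p (fun x => (M <= x k)%N%:R)%R <= t0%:E)%E) ->
  (forall k, (expect p (fun x => (x k)%:R ^+ 2 * (M <= x k)%N%:R)%R <= t2%:E)%E) ->
  (expect (iid_weight p) (fun s =>
    n%:R^-1 * (\sum_(c : cells) cell_error s (cell_pt c)) + V1 +
    \sum_i \sum_k (M <= s i k)%N%:R * ((s i k)%:R ^+ 2 + V2))%R <=
   (n%:R^-1 * (64 * (B * K) * M%:R ^+ d + 2 * K ^+ 2 * Wd) + 32 * K * k1 +
    V1 + n%:R * (d%:R * (t2 + V2 * t0)))%:E)%E.
Proof.
move=> V10 V20 tail1 low tau0 tau2.
have W0 s : 0 <= iid_weight p s by exact: iid_weight_ge0.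
have ce0 s : 0 <= \sum_(c : cells) cell_error s (cell_pt c).
  by apply: sumr_ge0 => c _; exact: cell_error_ge0.
have m0 x k : 0 <= (M <= x k)%N%:R * ((x k)%:R ^+ 2 + V2) :> R.
  by rewrite mulr_ge0// addr_ge0// sqr_ge0.
have nV0 : 0 <= n%:R^-1 :> R by rewrite invr_ge0.
apply: (@le_trans _ _ (n%:R^-1 * (64 * (B * K) * M%:R ^+ d + 2 * K ^+ 2 * Wd +
   32 * K * n%:R * k1) + V1 + n%:R * (d%:R * (t2 + V2 * t0)))%:E); last first.
  rewrite lee_fin le_eqVlt; apply/orP; left; apply/eqP.
  by field; rewrite gt_eqF.
apply: (@expect_leD _ _ _
  (fun s => n%:R^-1 * (\sum_(c : cells) cell_error s (cell_pt c)) + V1)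
  (fun s => \sum_i \sum_k (M <= s i k)%N%:R * ((s i k)%:R ^+ 2 + V2))) => //.
- by move=> s; rewrite addr_ge0// mulr_ge0.
- by move=> s; apply: sumr_ge0 => i _; exact: sumr_ge0.
- apply: (@expect_leD _ _ _
    (fun s => n%:R^-1 * (\sum_(c : cells) cell_error s (cell_pt c))) (fun=> V1)) => //.
  + by move=> s; rewrite mulr_ge0.
  + by apply: expect_leZ => //; exact: expect_cell_error.
  + by rewrite expect_iid_cst.
apply: (@expect_sum_coord_le _ _ n p p_ge0 p_sum1
  (fun x => \sum_k (M <= x k)%N%:R * ((x k)%:R ^+ 2 + V2))).
  by move=> x; exact: sumr_ge0.
rewrite (_ : d%:R * _ = \sum_(k < d) (t2 + V2 * t0)); last first.
  by rewrite sumr_const card_ord mulr_natl.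
apply: expect_le_sum => // k _.
rewrite (eq_expect _ (G := fun x => (x k)%:R ^+ 2 * (M <= x k)%N%:R +
  V2 * (M <= x k)%N%:R)); last by move=> x /=; ring.
apply: (@expect_leD _ _ _ (fun x => (x k)%:R ^+ 2 * (M <= x k)%N%:R)
  (fun x => V2 * (M <= x k)%N%:R)) => //.
- by move=> x; rewrite mulr_ge0// sqr_ge0.
- exact: expect_leZ.
Qed.

End CoordinateRegret.

(** * Rarely occupied cells *)

Section Occupancy.
Variable R : realType.
Implicit Types (u v h : R).

Lemma sqr_le_expR v : 0 <= v -> v ^+ 2 <= 2 * expR v.
Proof.
move=> v0; have := expR_ge1Dxn 1 v0; rewrite (_ : 2`! = 2)%N//; lra.
Qed.

Lemma le_expR v : v <= expR v.
Proof. have := expR_ge1Dx v; lra. Qed.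

Lemma mul_expRN_le4 u : u * expR (- (u / 4)) <= 4.
Proof.
rewrite expRN ler_pdivrMr ?expR_gt0//; have := le_expR (u / 4); lra.
Qed.

Definition sat u : R := u / (1 + u).

Lemma sat_ge0 u : 0 <= u -> 0 <= sat u.
Proof. by move=> u0; rewrite divr_ge0// addr_ge0. Qed.

Lemma sat_le1 u : 0 <= u -> sat u <= 1.
Proof. by move=> u0; rewrite ler_pdivrMr ?mul1r; lra. Qed.

Lemma sat_le u v : 0 <= u -> u <= v -> sat u <= sat v.
Proof.
move=> u0 uv; rewrite ler_pdivrMr; last by lra.
by rewrite mulrAC ler_pdivlMr; nra.
Qed.

(* [sat] is the potential that makes the sum of [u * expR (- (u / 4))] along a
   geometrically decaying sequence telescope. *)
Lemma mul_expRN_le_sat u : 0 <= u ->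
  u * expR (- (u / 4)) <= 46 * (sat u - sat (u / 2)).
Proof.
move=> u0; have u4 : 0 <= u / 4 by lra.
set E := expR (u / 4).
have E1 : 1 <= E by have := expR_ge1Dx (u / 4); rewrite -/E; lra.
have uE : u <= 4 * E by have := le_expR (u / 4); rewrite -/E; lra.
have u2E : u ^+ 2 <= 32 * E.
  by have := sqr_le_expR u4; rewrite -/E exprMn; lra.
have -> : sat u - sat (u / 2) = u / ((1 + u) * (2 + u)).
  by rewrite /sat; field; apply/andP; split; apply/eqP; lra.
rewrite expRN -/E ler_pdivrMr; last by lra.
rewrite (_ : 46 * _ * E = u * (46 * E / ((1 + u) * (2 + u)))); last by ring.
(* Source of 46: [(1 + u) (2 + u) = 2 + 3 u + u ^ 2 <= 2 E + 12 E + 32 E]. *)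
rewrite ler_peMr// ler_pdivlMr ?mul1r; first by lra.
by rewrite mulr_gt0//; lra.
Qed.

Lemma sum_below_le h m : 0 <= h -> \sum_(k < m) ((k.+1%:R < h)%R%:R : R) <= h.
Proof.
move=> h0; elim: m => [|m IH]; first by rewrite big_ord0.
rewrite big_ord_recr /=; case: ltP => mh; last by rewrite mulr0n addr0.
apply: (@le_trans _ _ (\sum_(k < m.+1) 1)); last first.
  by rewrite sumr_const card_ord; exact: ltW.
rewrite big_ord_recr /= lerD//.
by apply: ler_sum => k _; case: ltP => // _; exact: ler01.
Qed.

(** Once [k + 1 >= 2 h] the sequence at least halves and [sat] telescopes, for a total of at most
    46. Each of the at most [2 h] earlier indices costs 50: 4 for the term itself and 46 for a
    possibly negative increment of [sat]. *)
Lemma sum_fiber_le (u : nat -> R) h m : 0 <= h -> (forall k, 0 <= u k) ->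
  (forall k, k.+1%:R * u k.+1 <= h * u k) ->
  \sum_(k < m) u k * expR (- (u k / 4)) <= 46 + 100 * h.
Proof.
move=> h0 u0 uh.
apply: (@le_trans _ _ (\sum_(k < m) (46 * (sat (u k) - sat (u k.+1)) +
    50 * (k.+1%:R < 2 * h)%R%:R))).
  apply: ler_sum => k _; case: ltP => kh.
    rewrite mulr1n; have := mul_expRN_le4 (u k).
    have := sat_ge0 (u0 k); have := sat_le1 (u0 k.+1); lra.
  rewrite mulr0n mulr0 addr0; apply: le_trans (mul_expRN_le_sat (u0 k)) _.
  have : sat (u k.+1) <= sat (u k / 2).
    apply: sat_le => //; have k0 : 0 < k.+1%:R :> R by rewrite ltr0n.
    rewrite -(ler_pM2l k0); apply: le_trans (uh k) _.
    have := ler_wpM2r (u0 k) kh; lra.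
  lra.
rewrite big_split /= -!mulr_sumr.
have tele : \sum_(k < m) (sat (u k) - sat (u k.+1)) = sat (u 0%N) - sat (u m).
  elim: m => [|m IH]; first by rewrite big_ord0 subrr.
  by rewrite big_ord_recr /= IH; lra.
rewrite tele; have := sat_le1 (u0 0%N); have := sat_ge0 (u0 m).
have h2 : 0 <= 2 * h by lra.
have := sum_below_le m h2; lra.
Qed.

Variables (d M : nat) (j : 'I_d).
Local Notation cells := {ffun 'I_d -> 'I_M}.

Let upd (c : cells) (k : 'I_M) : cells := [ffun l => if l == j then k else c l].

(** Sums over lines in direction [j] without choosing representatives: exchanging [c j] with the
    free index [k] is an involution, and the redundancy is the factor [M]. *)
Lemma sum_cells_fibers (F : cells -> R) :
  M%:R * (\sum_c F c) = \sum_c \sum_k F (upd c k).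
Proof.
pose swap (z : cells * 'I_M) := (upd z.1 z.2, z.1 j).
have swapK : involutive swap.
  move=> [c k]; rewrite /swap /upd /=; congr (_, _); last by rewrite ffunE eqxx.
  by apply/ffunP => l; rewrite !ffunE; case: eqP => // ->.
rewrite pair_big /= [RHS](_ : _ = \sum_z F (swap z).1)//.
rewrite -(reindex_inj (inv_inj swapK) (P := xpredT) (F := fun z => F z.1)).
rewrite -(pair_big xpredT xpredT (fun c _ => F c)) /= mulr_sumr.
by apply: eq_bigr => c _; rewrite sumr_const card_ord mulr_natl.
Qed.

(** Each line costs [46 + 100 h] by [sum_fiber_le]; counting every line [M] times among [M ^ d]
    cells leaves [M ^ (d - 1)] lines. *)
Lemma sum_cells_occupancy (p : pt d -> R) h : 0 <= h -> (0 < M)%N ->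
  (forall x, 0 <= p x) ->
  (forall x : pt d, (x j).+1%:R * p (incr j x) <= h * p x) ->
  \sum_(c : cells) p (cell_pt c) * expR (- (p (cell_pt c) / 4)) <=
  M%:R ^+ d.-1 * (46 + 100 * h).
Proof.
move=> h0 M0 p0 ph; have M0R : 0 < M%:R :> R by rewrite ltr0n.
rewrite -(ler_pM2l M0R) sum_cells_fibers mulrA -exprS.
have -> : d.-1.+1 = d by rewrite prednK// (leq_ltn_trans _ (ltn_ord j)).
apply: (@le_trans _ _ (\sum_(c : cells) (46 + 100 * h))); last first.
  by rewrite sumr_const card_ffun !card_ord -(mulr_natl _ (M ^ d)) natrX.
apply: ler_sum => c _.
pose y (k : nat) : pt d := [ffun l => if l == j then k else cell_pt c l].
rewrite (eq_bigr (fun k : 'I_M => p (y k) * expR (- (p (y k) / 4)))).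
  apply: (sum_fiber_le (u := fun k => p (y k)) M h0) => // k.
  have := ph (y k); rewrite (_ : incr j (y k) = y k.+1).
    by rewrite ffunE eqxx.
  by apply/ffunP => l; rewrite !ffunE; case: eqP.
move=> k _; rewrite (_ : cell_pt (upd c k) = y k)//.
by apply/ffunP => l; rewrite !ffunE; case: eqP.
Qed.

End Occupancy.

(** * Tails *)

Section MomentBounds.
Variable R : realType.

(** From the second-order Bernoulli inequality. It lets a square be absorbed by enlarging the base
    of an exponential moment by the factor [1 + e]. *)
Lemma sqr_le_pow (e : R) m : 0 < e -> e <= 1 ->
  m%:R ^+ 2 <= 3 / e ^+ 2 * (1 + e) ^+ m.
Proof.
move=> e0 e1.
have bernoulli : 1 + m%:R * e + m%:R * (m%:R - 1) / 2 * e ^+ 2 <= (1 + e) ^+ m.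
  elim: m => [|m IH]; first by rewrite expr0; lra.
  rewrite [in leRHS]exprS; have e10 : 0 <= 1 + e by lra.
  apply: (le_trans _ (ler_wpM2l e10 IH)).
  have : 0 <= m%:R * (m%:R - 1) * e ^+ 3 :> R.
    rewrite mulr_ge0 ?exprn_ge0 ?(ltW e0)//.
    by case: m {IH} => [|m]; rewrite ?mul0r// mulr_ge0// subr_ge0 ler1n.
  rewrite -[m.+1%:R]natr1.
  have -> : (1 + e) * (1 + m%:R * e + m%:R * (m%:R - 1) / 2 * e ^+ 2) =
    1 + (m%:R + 1) * e + (m%:R + 1) * (m%:R + 1 - 1) / 2 * e ^+ 2 +
    m%:R * (m%:R - 1) * e ^+ 3 / 2 by field.
  lra.
rewrite mulrAC ler_pdivlMr ?exprn_gt0//.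
have m0 : 0 <= m%:R :> R by [].
have : 0 <= m%:R * e * (1 - e) by rewrite !mulr_ge0 ?(ltW e0) ?subr_ge0.
have : 0 <= m%:R ^+ 2 * e ^+ 2 by rewrite mulr_ge0 ?sqr_ge0.
have : 0 <= m%:R * e by rewrite mulr_ge0 ?(ltW e0).
have : m%:R * (m%:R - 1) / 2 * e ^+ 2 =
  m%:R ^+ 2 * e ^+ 2 / 2 - m%:R * e ^+ 2 / 2 by field.
have : m%:R * e * (1 - e) = m%:R * e - m%:R * e ^+ 2 by ring.
lra.
Qed.

Lemma geometric_sum_le12 N : \sum_(k < N) (4 * (2 / 3) ^+ k) <= 12 :> R.
Proof.
suff -> : \sum_(k < N) (4 * (2 / 3) ^+ k) = 12 * (1 - (2 / 3) ^+ N) :> R.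
  by have : 0 <= (2 / 3) ^+ N :> R by []; lra.
elim: N => [|N IH]; first by rewrite big_ord0 expr0 subrr mulr0.
by rewrite big_ord_recr /= IH exprS; field.
Qed.

Lemma expR_half_bounds : expR 2^-1 <= 2 :> R /\ expR (- 2^-1) <= 2 / 3 :> R.
Proof.
have h := expR_ge1Dx (2^-1 : R); have h' := expR_ge1Dx (- 2^-1 : R).
have e0 : 0 < expR (2^-1 : R) by exact: expR_gt0.
have inv : expR (- 2^-1) * expR 2^-1 = 1 :> R by rewrite -expRD addNr expR0.
by split; nra.
Qed.

End MomentBounds.

(** * Tails of the observations and of the Bayes estimator *)

Section MixtureTails.
Variables (R : realType) (d : nat) (d0 : measure_display) (T : measurableType d0)
  (P : probability T R) (theta : 'I_d -> T -> R).
Hypothesis mtheta : forall j, measurable_fun [set: T] (theta j).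
Hypothesis theta0 : forall j t, 0 <= theta j t.
Local Notation p := (Defs.pmf P theta).
Implicit Types (j k : 'I_d) (C b e h s c : R).

Let p0 (x : pt d) : 0 <= p x. Proof. exact: mixture_pmf_ge0. Qed.

Lemma pmf_tail k b C (M : nat) : 1 <= b ->
  (\int[P]_t (expR ((b - 1) * theta k t))%:E <= C%:E)%E ->
  (expect p (fun x => (M <= x k)%N%:R)%R <= (b ^- M * C)%:E)%E.
Proof.
move=> b1 EC; have b0 : 0 < b by lra.
have bM0 : 0 <= b ^- M by rewrite invr_ge0 exprn_ge0// ltW.
apply: (@le_trans _ _ (expect p (fun x => b ^- M * b ^+ x k)%R)); last first.
  apply: expect_leZ => //; first by move=> x; rewrite exprn_ge0// ltW.
  by rewrite expect_pow_coord// ltW.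
apply: le_expect => // x; have [Mx|_] := leqP M (x k); last first.
  by rewrite mulr0n; apply: mulr_ge0 => //; apply: exprn_ge0; exact: ltW.
by rewrite mulr1n ler_pdivlMl ?exprn_gt0// mulr1 ler_weXn2l.
Qed.

(** Markov's inequality with base [b (1 + e)]: the factor [b] pays for the tail and [1 + e] for the
    square. *)
Lemma pmf_tail_sqr k b e C (M : nat) : 1 <= b -> 0 < e -> e <= 1 ->
  (\int[P]_t (expR ((b * (1 + e) - 1) * theta k t))%:E <= C%:E)%E ->
  (expect p (fun x => (x k)%:R ^+ 2 * (M <= x k)%N%:R)%R <=
   (3 / e ^+ 2 * b ^- M * C)%:E)%E.
Proof.
move=> b1 e0 e1 EC; have b0 : 0 < b by lra.
have bM0 : 0 <= b ^- M by rewrite invr_ge0 exprn_ge0// ltW.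
have c0 : 0 <= 3 / e ^+ 2 by rewrite divr_ge0// sqr_ge0.
have be0 : 0 <= b * (1 + e) by rewrite mulr_ge0//; lra.
apply: (@le_trans _ _ (expect p (fun x =>
    3 / e ^+ 2 * b ^- M * (b * (1 + e)) ^+ x k)%R)); last first.
  apply: expect_leZ => //; first by move=> x; rewrite exprn_ge0.
    by rewrite mulr_ge0.
  by rewrite expect_pow_coord.
apply: le_expect => // x; have [Mx|_] := leqP M (x k); last first.
  by rewrite mulr0n mulr0; apply: mulr_ge0; [exact: mulr_ge0|exact: exprn_ge0].
rewrite mulr1n mulr1; apply: le_trans (sqr_le_pow _ e0 e1) _.
set c3 := 3 / e ^+ 2 in c0 *.
rewrite exprMn -[c3 * _ * _]mulrA ler_wpM2l// mulrA ler_peMl//.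
  by apply: exprn_ge0; lra.
by rewrite ler_pdivlMl ?exprn_gt0// mulr1 ler_weXn2l.
Qed.

Lemma integral_expR_bounded k h c : 0 <= c ->
  P [set t | forall j, theta j t <= h] = 1%E ->
  (\int[P]_t (expR (c * theta k t))%:E <= (expR (c * h))%:E)%E.
Proof.
move=> c0 Ph.
have aeh := ae_bounded mtheta Ph.
have me : measurable_fun [set: T] (fun t => expR (c * theta k t)).
  by apply: measurableT_comp => //; exact: measurable_funM.
rewrite -[leRHS]mule1 -(integral1_probability P).
rewrite -integral_EFinZ ?expR_ge0//.
apply: ae_ge0_le_integral => //.
- exact/measurable_EFinP.
- by apply: filterS aeh => t H _; rewrite mulr1 lee_fin ler_expR ler_wpM2l.
Qed.

(** Slice by [m = floor (theta / s)]: the exponential is at most [exp ((m + 1) / 2)] on a slice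
    whose upper tail has mass at most [2 exp (- m)]. The products are below [4 (2/3) ^ m], with sum
    at most 12. *)
Lemma integral_expR_subexp k s : 0 < s ->
  (forall t, 0 < t -> (P [set u | (t <= theta k u)%R] <=
     (2 * expR (- (t / s)))%:E)%E) ->
  (\int[P]_t (expR ((2 * s)^-1 * theta k t))%:E <= 12%:E)%E.
Proof.
move=> s0 tail.
pose A m := [set t | m%:R * s <= theta k t].
have mA m : measurable (A m).
  by rewrite -[X in measurable X]setTI; exact: measurable_fun_le.
pose a m : R := expR ((m%:R + 1) / 2).
have a0 m : 0 <= a m by exact: expR_ge0.
have PA m : (P (A m) <= (2 * expR (- m%:R))%:E)%E.
  (* The tail hypothesis covers only [t > 0], so level 0 uses that a probability is at most 1. *)
  case: m => [|m].
    apply: le_trans (probability_le1 P (mA 0%N)) _.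
    by rewrite oppr0 expR0 lee_fin; lra.
  apply: le_trans (tail (m.+1%:R * s) _) _; first by rewrite mulr_gt0.
  by rewrite mulfK ?gt_eqF.
have mterm m : measurable_fun [set: T] (fun t => a m * \1_(A m) t).
  by apply: measurable_funM => //; exact: measurable_indic.
apply: (@le_trans _ _ (\int[P]_t (\sum_(m <oo) (a m * \1_(A m) t)%:E))%E).
  apply: ge0_le_integral => //.
  - apply/measurable_EFinP; apply: measurableT_comp => //.
    exact: measurable_funM.
  - have := @ge0_emeasurable_sum _ T R setT (fun m t => (a m * \1_(A m) t)%:E) xpredT.
    move=> H; apply: H => [m t _ _|m _]; first by rewrite lee_fin mulr_ge0.
    exact/measurable_EFinP.
  move=> t _; pose m := Num.truncn (theta k t / s).
  have ts0 : 0 <= theta k t / s by rewrite divr_ge0// ltW.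
  have /andP[mle mgt] : m%:R <= theta k t / s < m.+1%:R by exact: truncn_itv.
  apply: (@le_trans _ _ (a m * \1_(A m) t)%:E).
    rewrite indicE mem_set; last by rewrite /A /= -ler_pdivlMr.
    rewrite mulr1 lee_fin ler_expR.
    have -> : (2 * s)^-1 * theta k t = theta k t / s / 2 by field; rewrite gt_eqF.
    by rewrite ler_wpM2r// natr1 ltW.
  rewrite nneseries_esumT; last by move=> i; rewrite lee_fin mulr_ge0.
  apply: esum_ge; exists [set m]; last by rewrite fsbig_set1.
  by split=> //; exact: finite_set1.
rewrite integral_nneseries//; first last.
- by move=> m t _; rewrite lee_fin mulr_ge0.
- by move=> m; exact/measurable_EFinP.
apply: lime_le.
  by apply: is_cvg_nneseries => m _ _; apply: integral_ge0 => t _; rewrite lee_fin mulr_ge0.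
apply: nearW => N; rewrite big_mkord.
apply: le_trans (_ : (\sum_(m < N) (4 * (2 / 3) ^+ m))%:E <= _)%E; last first.
  by rewrite lee_fin geometric_sum_le12.
rewrite -sumEFin; apply: lee_sum => m _.
have mI : measurable_fun [set: T] (\1_(A m) : T -> R) by exact: measurable_indic.
have I0 t : 0 <= \1_(A m) t :> R by [].
rewrite (integral_EFinZ P mI I0 (a0 m)).
rewrite integral_indic// setIT.
apply: (@le_trans _ _ ((a m)%:E * (2 * expR (- m%:R))%:E)%E).
  by apply: lee_wpmul2l; [rewrite lee_fin; exact: a0|exact: PA].
rewrite -EFinM lee_fin /a.
have -> : expR ((m%:R + 1) / 2) * (2 * expR (- m%:R)) =
    2 * expR 2^-1 * expR (- 2^-1) ^+ m :> R.
  by rewrite -expRM_natl mulrCA -mulrA -!expRD; congr (_ * expR _); field.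
have [e1 e2] := expR_half_bounds R.
apply: ler_pM; rewrite ?mulr_ge0 ?exprn_ge0 ?expR_ge0//; first by lra.
by rewrite lerXn2r// ?nnegrE ?expR_ge0.
Qed.

(** With [v = fs x / (4 s)] the available moment is that of [exp v * exp v]: one factor dominates
    the power, as [(4 v) ^ q <= 32 exp v] for [q <= 2], and the other yields the decay in [B]. *)
Lemma expect_trunc (fs : pt d -> R) s C (B : R) (q : nat) : 0 < s -> (q <= 2)%N ->
  (forall x, 0 <= fs x) ->
  (expect p (fun x => expR ((2 * s)^-1 * fs x))%R <= C%:E)%E ->
  (expect p (fun x => fs x ^+ q * (B < fs x)%R%:R)%R <=
   (32 * s ^+ q * expR (- (B / (4 * s))) * C)%:E)%E.
Proof.
move=> s0 q2 fs0 EC.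
have s4 : 0 < 4 * s by lra.
have c0 : 0 <= 32 * s ^+ q * expR (- (B / (4 * s))).
  by rewrite !mulr_ge0 ?expR_ge0 ?exprn_ge0 ?(ltW s0).
apply: (@le_trans _ _ (expect p (fun x =>
   32 * s ^+ q * expR (- (B / (4 * s))) * expR ((2 * s)^-1 * fs x))%R)); last first.
  by apply: expect_leZ => // x; exact: expR_ge0.
apply: le_expect => // x; case: ltP => Bf; last first.
  by rewrite mulr0n mulr0 mulr_ge0// expR_ge0.
rewrite mulr1n mulr1; set v := fs x / (4 * s).
have v0 : 0 <= v by rewrite divr_ge0// ltW.
have fE : fs x = s * (4 * v) by rewrite /v; field; rewrite gt_eqF.
have -> : (2 * s)^-1 * fs x = v + v by rewrite fE; field; rewrite gt_eqF.
rewrite expRD mulrA -mulrA -mulrA.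
have Bv : 1 <= expR (- (B / (4 * s))) * expR v.
  rewrite -expRD -[leLHS]expR0 ler_expR addrC subr_ge0.
  by rewrite ler_pM2r ?invr_gt0// ltW.
have V1 : 1 <= expR v by have := expR_ge1Dx v; lra.
have powq : (4 * v) ^+ q <= 32 * expR v.
  case: q q2 {c0} => [|[|[|//]]] _; rewrite ?expr0 ?expr1.
  - by lra.
  - by have := le_expR v; lra.
  - by rewrite (_ : (4 * v) ^+ 2 = 16 * v ^+ 2); [have := sqr_le_expR v0; lra|ring].
rewrite fE exprMn.
apply: (@le_trans _ _ (s ^+ q * (32 * expR v))).
  by rewrite ler_wpM2l// exprn_ge0// ltW.
set E1 := expR (- _) in Bv *; set V := expR v in Bv V1 *.
have -> : 32 * s ^+ q * (E1 * (V * V)) = s ^+ q * (32 * V) * (E1 * V) by ring.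
by rewrite ler_peMr// mulr_ge0 ?exprn_ge0 ?(ltW s0)//; lra.
Qed.

End MixtureTails.

(** * Rates *)

Section RegretBound.
Variables (R : realType) (d n : nat) (d0 : measure_display) (T : measurableType d0)
  (P : probability T R) (theta : 'I_d -> T -> R).
Hypothesis n_gt0 : (0 < n)%N.
Hypothesis mtheta : forall j, measurable_fun [set: T] (theta j).
Hypothesis theta0 : forall j t, 0 <= theta j t.
Local Notation p := (Defs.pmf P theta).
Local Notation fstar := (bayes P theta).

(** The truncation levels, the tail quantities and the occupancy sum [Wd] stay abstract, so that
    both classes of priors use the same bound. *)
Lemma regret_erm_le (fhat : sample d n -> estimator R d) (M : nat)
    (B k0 k1 k2 t0 t2 Wd : R) : 0 <= B ->
  (forall s, is_erm s (fhat s)) ->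
  (forall j, (expect p (fun x => (B < fstar x j)%R%:R)%R <= k0%:E)%E) ->
  (forall j, (expect p (fun x => fstar x j * (B < fstar x j)%R%:R)%R <= k1%:E)%E) ->
  (forall j, (expect p (fun x => fstar x j ^+ 2 * (B < fstar x j)%R%:R)%R <= k2%:E)%E) ->
  (forall k, (expect p (fun x => (M <= x k)%N%:R)%R <= t0%:E)%E) ->
  (forall k, (expect p (fun x => (x k)%:R ^+ 2 * (M <= x k)%N%:R)%R <= t2%:E)%E) ->
  (forall j, \sum_(c : {ffun 'I_d -> 'I_M})
    (if good_pt p (fstar ^~ j) B (cell_pt c) then
    n%:R * p (cell_pt c) * expR (- (n%:R * p (cell_pt c) / 4)) else 0) <= Wd) ->
  (regret P theta fhat <= (d%:R * (
    n%:R^-1 * (64 * (B * (B + M%:R)) * M%:R ^+ d + 2 * (B + M%:R) ^+ 2 * Wd) +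
    32 * (B + M%:R) * k1 + (d%:R * (t0 * (M%:R ^+ 2 + B ^+ 2)) + (M%:R ^+ 2 * k0 + k2)) +
    n%:R * (d%:R * (t2 + (B ^+ 2 + k2) * t0))))%:E)%E.
Proof.
move=> B0 erm H0 H1 H2 T0 T2 HW.
have p0 x : 0 <= p x by exact: mixture_pmf_ge0.
have p1 : expect p (fun=> 1) = 1%E by exact: mixture_pmf_sum1.
have f0 x j : 0 <= fstar x j by exact: bayes_ge0.
have W0 (s : sample d n) : 0 <= iid_weight p s by exact: iid_weight_ge0.
have ind0 x j : 0 <= (B < fstar x j)%R%:R :> R by [].
have fB0 x j : 0 <= fstar x j ^+ 2 * (B < fstar x j)%R%:R.
  by rewrite mulr_ge0// sqr_ge0.
have nonneg (F : pt d -> R) c : (forall x, 0 <= F x) -> (expect p F <= c%:E)%E -> 0 <= c.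
  by move=> F0 Fc; rewrite -lee_fin; apply: le_trans Fc; exact: expect_ge0.
have MB0 : 0 <= M%:R ^+ 2 + B ^+ 2 by rewrite addr_ge0// sqr_ge0.
set V1 := d%:R * (t0 * _) + _; set V2 := B ^+ 2 + k2.
have HV2 j : (expect p (fun x => fstar x j ^+ 2)%R <= V2%:E)%E.
  apply: (@le_trans _ _ (expect p (fun x => B ^+ 2 +
      fstar x j ^+ 2 * (B < fstar x j)%R%:R)%R)).
    apply: le_expect => // x; case: ltP => Bf.
      by rewrite mulr1n mulr1 lerDr sqr_ge0.
    by rewrite mulr0n mulr0 addr0 lerXn2r// nnegrE.
  apply: (@expect_leD _ _ p (fun=> B ^+ 2)
    (fun x => fstar x j ^+ 2 * (B < fstar x j)%R%:R)) => //.
    by move=> x; exact: sqr_ge0.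
  by rewrite (expect_cst p0 p1 (sqr_ge0 B)).
have HV1 j : (expect p (fun x => \sum_k (M <= x k)%N%:R * (M%:R ^+ 2 + B ^+ 2) +
     (B < fstar x j)%R%:R * (M%:R ^+ 2 + fstar x j ^+ 2))%R <= V1%:E)%E.
  rewrite /V1; apply: (@expect_leD _ _ p
    (fun x => \sum_k (M <= x k)%N%:R * (M%:R ^+ 2 + B ^+ 2))
    (fun x => (B < fstar x j)%R%:R * (M%:R ^+ 2 + fstar x j ^+ 2))) => //.
  - by move=> x; apply: sumr_ge0 => k _; rewrite mulr_ge0.
  - by move=> x; rewrite mulr_ge0// addr_ge0 ?sqr_ge0.
  - rewrite (_ : d%:R * _ = \sum_(k < d) (t0 * (M%:R ^+ 2 + B ^+ 2))); last first.
      by rewrite sumr_const card_ord mulr_natl.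
    apply: expect_le_sum => // [k x|k _]; first by rewrite mulr_ge0.
    rewrite [t0 * _]mulrC (eq_expect _
      (G := fun x : pt d => (M%:R ^+ 2 + B ^+ 2) * (M <= x k)%N%:R)).
      by apply: expect_leZ => //; exact: T0.
    by move=> x; rewrite /= mulrC.
  - rewrite (eq_expect _ (G := fun x => M%:R ^+ 2 * (B < fstar x j)%R%:R +
      fstar x j ^+ 2 * (B < fstar x j)%R%:R)); last by move=> x /=; ring.
    apply: (@expect_leD _ _ p (fun x => M%:R ^+ 2 * (B < fstar x j)%R%:R)
      (fun x => fstar x j ^+ 2 * (B < fstar x j)%R%:R)) => //.
    by apply: expect_leZ => //; exact: H0.
(* The signs of [k2] and [V1] are read off from some coordinate, so dimension 0 is separated; its
   excess risk is zero. *)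
have [d00|dpos] := posnP d.
  have d0R : d%:R = 0 :> R by rewrite d00.
  apply: (@regret_le _ _ _ _ _ _ mtheta theta0 _ _ (fun=> 0)).
  - by move=> s x j; have [/(_ x j)[]] := erm s.
  - move=> s; rewrite /expect esum1// => x _.
    by rewrite big1 ?mulr0// => j; have := ltn_ord j; rewrite [X in (_ < X)%N]d00.
  - by rewrite d0R mul0r expect_iid_cst.
pose j0 := Ordinal dpos.
have k20 : 0 <= k2 := nonneg _ _ (fB0 ^~ j0) (H2 j0).
have V20 : 0 <= V2 by rewrite addr_ge0// sqr_ge0.
have V10 : 0 <= V1.
  apply: nonneg (HV1 j0) => x; apply: addr_ge0.
    by apply: sumr_ge0 => k _; rewrite mulr_ge0.
  by rewrite mulr_ge0// addr_ge0 ?sqr_ge0.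
pose D (j : 'I_d) (s : sample d n) : R :=
  n%:R^-1 * (\sum_(c : {ffun 'I_d -> 'I_M}) @cell_error R d n M j p (fstar ^~ j) B s (cell_pt c)) +
  V1 + \sum_i \sum_k (M <= s i k)%N%:R * ((s i k)%:R ^+ 2 + V2).
have fmon j x : fstar x j <= fstar (incr j x) j by exact: le_bayes_incr.
have bal j x : fstar x j * p x = (x j).+1%:R * p (incr j x) by exact: bayesE.
have D0 j s : 0 <= D j s.
  rewrite /D addr_ge0//; last first.
    by do 2 (apply: sumr_ge0 => ? _); rewrite mulr_ge0// addr_ge0// sqr_ge0.
  rewrite addr_ge0// mulr_ge0 ?invr_ge0// sumr_ge0// => c _.
  exact: cell_error_ge0.
apply: (@regret_le _ _ _ _ _ _ mtheta theta0 _ _ (fun s => \sum_j D j s)).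
- by move=> s x j; have [/(_ x j)[]] := erm s.
- move=> s; apply: expect_le_sum => // [j x|j _]; first exact: sqr_ge0.
  apply: (@coord_excess_le R d n M j p (fstar ^~ j) B) => //.
  + by move=> x; have [/(_ x j)[]] := erm s.
  + by move=> m sm x; exact: (erm_le_max (erm s)).
  + by move=> g g0 gmon; exact: (erm_basic_ineq (erm s)).
rewrite (_ : d%:R * _ = \sum_(j < d) (
    n%:R^-1 * (64 * (B * (B + M%:R)) * M%:R ^+ d + 2 * (B + M%:R) ^+ 2 * Wd) +
    32 * (B + M%:R) * k1 + V1 + n%:R * (d%:R * (t2 + V2 * t0)))); last first.
  by rewrite sumr_const card_ord mulr_natl.
apply: expect_le_sum => // j _.
exact: expect_coord_bound.
Qed.

End RegretBound.

(** * Numerical inequalities behind the two rates *)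

Section Arithmetic.
Variable R : realType.
Implicit Types (v dd h H X U M m s B w l L : R).

(** Here [v] is [n] and [dd] is [d]. Tails of order [n ^ (-4)] remain below [1 / n] after
    multiplication by both [n] and [d], thanks to [d <= n]. *)
Lemma inv_sample_size v dd : 1 <= v -> 0 <= dd -> dd <= v ->
  [/\ 0 <= v^-1, v^-1 <= 1, dd * v^-1 ^+ 4 <= v^-1 & v * (dd * v^-1 ^+ 4) <= v^-1].
Proof.
move=> v1 dd0 ddv; have v0 : 0 < v by lra.
have w0 : 0 <= v^-1 by rewrite invr_ge0 ltW.
have w1 : v^-1 <= 1 by rewrite invf_le1.
have dw : dd * v^-1 <= 1 by rewrite ler_pdivrMr ?mul1r.
have vw : v * v^-1 = 1 by rewrite mulfV ?gt_eqF.
have w2 : v^-1 ^+ 2 <= v^-1 by rewrite expr2 ler_piMl.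
have w3 : v^-1 ^+ 3 <= v^-1 by rewrite exprS ler_piMr// (le_trans w2).
split=> //.
  rewrite exprS mulrA; apply: le_trans w3.
  by rewrite ler_piMl// exprn_ge0.
set w := v^-1 in w0 vw dw w2 *; apply: le_trans w2.
have -> : v * (dd * w ^+ 4) = dd * w * (v * w) * w ^+ 2 by ring.
by rewrite vw mulr1 ler_piMl// exprn_ge0.
Qed.

(** Read [m] as [M ^ (d - 1)], [X] as [H L] with [L = ln n / ln ln n], and [U] as [X ^ (d - 1)]. The
    zeros are the truncated moments of the Bayes estimator, which vanish at level [h]. *)
Lemma bounded_case_arith v dd h H X U M m : 1 <= v -> 0 <= dd -> dd <= v ->
  0 <= h -> H = 5 + 2 * h -> H <= X -> 0 <= M -> M <= X -> 0 <= m -> m <= U -> 1 <= U ->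
  dd * (v^-1 * (64 * (h * (h + M)) * (M * m) +
        2 * (h + M) ^+ 2 * (m * (46 + 100 * h))) + 32 * (h + M) * 0 +
    (dd * (v^-1 ^+ 4 * (M ^+ 2 + h ^+ 2)) + (M ^+ 2 * 0 + 0)) +
    v * (dd * (3 * v^-1 ^+ 4 + (h ^+ 2 + 0) * v^-1 ^+ 4))) <=
  31 * 1000 * (dd * v^-1) * (H * X * (X * U)).
Proof.
move=> v1 dd0 ddv h0 HE HX M0 MX m0 mU U1.
have [w0 w1 dw4 vdw4] := inv_sample_size v1 dd0 ddv.
rewrite !mulr0 !addr0 (_ : 31 * 1000 * (dd * v^-1) * (H * X * (X * U)) =
  dd * (31 * 1000 * (v^-1 * (H * X * (X * U))))); last by ring.
apply: ler_wpM2l => //; set w := v^-1 in w0 w1 dw4 vdw4 *.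
have X1 : 1 <= X by lra.
have Kle : h + M <= 2 * X by lra.
have XU : X <= X * U by rewrite ler_peMr//; lra.
have HXY : H * X <= H * X * (X * U) by rewrite ler_peMr ?mulr_ge0//; lra.
have X2Y : X ^+ 2 <= H * X * (X * U).
  rewrite (_ : H * X * (X * U) = X ^+ 2 * (H * U)); last by ring.
  by rewrite ler_peMr ?sqr_ge0//; nra.
set Y := H * X * (X * U) in HXY X2Y *.
have Y0 : 0 <= Y by apply: le_trans X2Y; exact: sqr_ge0.
have a1 : h * (h + M) * (M * m) <= 2 * Y.
  rewrite (_ : 2 * Y = H * (2 * X) * (X * U)); last by rewrite /Y; ring.
  by apply: ler_pM; rewrite ?mulr_ge0 ?addr_ge0//; apply: ler_pM; rewrite ?addr_ge0//; lra.
have a2 : (h + M) ^+ 2 * (m * (46 + 100 * h)) <= 200 * Y.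
  rewrite (_ : 200 * Y = (2 * X) ^+ 2 * (U * (50 * H))); last by rewrite /Y; ring.
  apply: ler_pM; rewrite ?sqr_ge0 ?mulr_ge0//; first by lra.
    by rewrite lerXn2r// nnegrE; lra.
  by apply: ler_pM => //; lra.
have hX : h ^+ 2 <= X ^+ 2 by rewrite lerXn2r// ?nnegrE; lra.
have MX2 : M ^+ 2 <= X ^+ 2 by rewrite lerXn2r// ?nnegrE; lra.
have X21 : 1 <= X ^+ 2 by rewrite exprn_ege1.
have a3 : dd * (w ^+ 4 * (M ^+ 2 + h ^+ 2)) <= w * (2 * Y).
  rewrite mulrA; apply: ler_pM => //; last by lra.
    by rewrite mulr_ge0// exprn_ge0.
  by rewrite addr_ge0 ?sqr_ge0.
have a4 : v * (dd * (3 * w ^+ 4 + h ^+ 2 * w ^+ 4)) <= w * (4 * Y).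
  rewrite -mulrDl [_ * w ^+ 4]mulrC 2!mulrA -[v * _ * _]mulrA.
  apply: ler_pM => //; last by lra.
    by rewrite !mulr_ge0 ?exprn_ge0//; lra.
  by rewrite addr_ge0 ?sqr_ge0.
have a12 : 64 * (h * (h + M)) * (M * m) + 2 * (h + M) ^+ 2 * (m * (46 + 100 * h)) <=
    528 * Y by rewrite -!mulrA in a1 a2 *; lra.
have := ler_wpM2l w0 a12; have := mulr_ge0 w0 Y0.
lra.
Qed.

(** Read [m] as [M ^ d] and [U] as [X ^ d]. The contributions add up to
    [160 + 24576 + 24 + 768 + 4700 = 30228], rounded up to the constant 31000 shared by both
    cases. *)
Lemma subexp_case_arith v dd s X U B M m : 1 <= v -> 0 <= dd -> dd <= v ->
  0 <= s -> 4 * s + 1 <= X -> 0 <= B -> B <= X -> 0 <= M -> M <= X ->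
  0 <= m -> m <= U -> 1 <= U ->
  dd * (v^-1 * (64 * (B * (B + M)) * m + 2 * (B + M) ^+ 2 * (4 * m)) +
    32 * (B + M) * (384 * s * v^-1 ^+ 4) +
    (dd * (12 * v^-1 ^+ 4 * (M ^+ 2 + B ^+ 2)) +
      (M ^+ 2 * (384 * v^-1 ^+ 4) + 384 * s ^+ 2 * v^-1 ^+ 4)) +
    v * (dd * (36 * (4 * s + 1) ^+ 2 * v^-1 ^+ 4 +
      (B ^+ 2 + 384 * s ^+ 2 * v^-1 ^+ 4) * (12 * v^-1 ^+ 4)))) <=
  31 * 1000 * (dd * v^-1) * (X ^+ 2 * U).
Proof.
move=> v1 dd0 ddv s0 sX B0 BX M0 MX m0 mU U1.
have [w0 w1 dw4 vdw4] := inv_sample_size v1 dd0 ddv.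
rewrite (_ : 31 * 1000 * (dd * v^-1) * (X ^+ 2 * U) =
  dd * (31 * 1000 * (v^-1 * (X ^+ 2 * U)))); last by ring.
apply: ler_wpM2l => //; set w := v^-1 in w0 w1 dw4 vdw4 *.
have X1 : 1 <= X by lra.
have w40 : 0 <= w ^+ 4 by exact: exprn_ge0.
have w4w : w ^+ 4 <= w by rewrite exprS ler_piMr// exprn_ile1.
have w41 : w ^+ 4 <= 1 by rewrite exprn_ile1.
have X2Y : X ^+ 2 <= X ^+ 2 * U by rewrite ler_peMr ?sqr_ge0.
set Y := X ^+ 2 * U in X2Y *.
have Y0 : 0 <= Y by apply: le_trans X2Y; exact: sqr_ge0.
have sq a : 0 <= a -> a <= X -> a ^+ 2 <= X ^+ 2.
  by move=> a0 aX; rewrite lerXn2r// nnegrE; lra.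
have B2 := sq _ B0 BX; have M2 := sq _ M0 MX.
have s2 : s ^+ 2 <= X ^+ 2 by apply: sq; lra.
have s42 : (4 * s + 1) ^+ 2 <= X ^+ 2 by apply: sq; lra.
have a1 : B * (B + M) * m <= 2 * Y.
  rewrite (_ : 2 * Y = X * (2 * X) * U); last by rewrite /Y; ring.
  apply: ler_pM => //; first by rewrite mulr_ge0 ?addr_ge0.
  by apply: ler_pM; rewrite ?addr_ge0//; lra.
have a2 : (B + M) ^+ 2 * m <= 4 * Y.
  rewrite (_ : 4 * Y = (2 * X) ^+ 2 * U); last by rewrite /Y; ring.
  apply: ler_pM => //; first by rewrite sqr_ge0.
  by rewrite lerXn2r// ?nnegrE; lra.
have a12 : w * (64 * (B * (B + M)) * m + 2 * (B + M) ^+ 2 * (4 * m)) <= w * (160 * Y).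
  by apply: ler_wpM2l => //; lra.
have a3 : (B + M) * s * w ^+ 4 <= 2 * Y * w.
  apply: ler_pM => //; first by rewrite mulr_ge0 ?addr_ge0.
  apply: (@le_trans _ _ (2 * X * X)); last by lra.
  by apply: ler_pM; rewrite ?addr_ge0//; lra.
have a4 : dd * w ^+ 4 * (M ^+ 2 + B ^+ 2) <= w * (2 * Y).
  by apply: ler_pM => //; rewrite ?mulr_ge0 ?addr_ge0 ?sqr_ge0//; lra.
have a5 : M ^+ 2 * w ^+ 4 <= Y * w by apply: ler_pM => //; rewrite ?sqr_ge0//; lra.
have a6 : s ^+ 2 * w ^+ 4 <= Y * w by apply: ler_pM => //; rewrite ?sqr_ge0//; lra.
have vd0 : 0 <= v * (dd * w ^+ 4) by rewrite !mulr_ge0//; lra.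
have sw : s ^+ 2 * w ^+ 4 <= Y.
  by apply: (@le_trans _ _ (s ^+ 2)); [rewrite ler_piMr ?sqr_ge0|lra].
have a7 : v * (dd * w ^+ 4) * (36 * (4 * s + 1) ^+ 2 +
    (B ^+ 2 + 384 * (s ^+ 2 * w ^+ 4)) * 12) <= w * (47 * 100 * Y).
  have sw0 : 0 <= s ^+ 2 * w ^+ 4 by rewrite mulr_ge0 ?sqr_ge0.
  have := sqr_ge0 (4 * s + 1); have := sqr_ge0 B => sB0 s410.
  have q0 : 0 <= 36 * (4 * s + 1) ^+ 2 +
    (B ^+ 2 + 384 * (s ^+ 2 * w ^+ 4)) * 12 by lra.
  apply: (ler_pM vd0 q0 vdw4); lra.
have E7 : v * (dd * (36 * (4 * s + 1) ^+ 2 * w ^+ 4 +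
      (B ^+ 2 + 384 * s ^+ 2 * w ^+ 4) * (12 * w ^+ 4))) =
  v * (dd * w ^+ 4) * (36 * (4 * s + 1) ^+ 2 +
    (B ^+ 2 + 384 * (s ^+ 2 * w ^+ 4)) * 12) by ring.
rewrite E7; have := mulr_ge0 w0 Y0.
have -> : 32 * (B + M) * (384 * s * w ^+ 4) = 32 * 384 * ((B + M) * s * w ^+ 4) by ring.
have -> : dd * (12 * w ^+ 4 * (M ^+ 2 + B ^+ 2)) =
  12 * (dd * w ^+ 4 * (M ^+ 2 + B ^+ 2)) by ring.
rewrite [M ^+ 2 * _]mulrCA -[384 * s ^+ 2 * _]mulrA.
lra.
Qed.

(** Amounts to [exp 1 < 3]: [exp (- 1/6) >= 5/6], and [(5/6) ^ 6] just exceeds [1/3]. It makes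
    [ln (ln n)] positive. *)
Lemma one_lt_ln n : (3 <= n)%N -> 1 < ln n%:R :> R.
Proof.
move=> n3; have n0 : 0 < n%:R :> R by rewrite ltr0n (leq_trans _ n3).
rewrite -ltr_expR lnK ?posrE//; apply: (@lt_le_trans _ _ 3); last by rewrite ler_nat.
have e : (5 / 6) ^+ 6 <= expR (-1) :> R.
  have -> : -1 = 6%:R * (- 6^-1) :> R by field.
  rewrite expRM_natl lerXn2r ?nnegrE ?expR_ge0//.
  by have := expR_ge1Dx (- 6^-1 : R); lra.
have inv : expR (-1) * expR 1 = 1 :> R by rewrite -expRD addNr expR0.
have e0 : 0 < expR 1 :> R by exact: expR_gt0.
have e13 : 1 / 3 < expR (-1) :> R by apply: lt_le_trans e; lra.
nra.
Qed.

Lemma expR_N4ln n : (0 < n)%N -> expR (- (4 * ln n%:R)) = n%:R^-1 ^+ 4 :> R.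
Proof.
by move=> n0; rewrite expRN expRM_natl lnK ?posrE ?ltr0n// exprVn.
Qed.

End Arithmetic.

(** * Bounded and subexponential priors *)

Section Rates.
Variables (R : realType) (d n : nat) (d0 : measure_display) (T : measurableType d0)
  (P : probability T R) (theta : 'I_d -> T -> R).
Hypothesis d_gt0 : (0 < d)%N.
Hypothesis n_ge3 : (3 <= n)%N.
Hypothesis d_le_n : (d <= n)%N.
Hypothesis mtheta : forall j, measurable_fun [set: T] (theta j).
Hypothesis theta0 : forall j t, 0 <= theta j t.
Variable fhat : sample d n -> estimator R d.
Hypothesis erm : forall s, is_erm s (fhat s).
Local Notation p := (Defs.pmf P theta).
Local Notation fstar := (bayes P theta).
Local Notation l := (ln n%:R : R).
Local Notation w := (n%:R^-1 : R).

Let n_gt0 : (0 < n)%N. Proof. exact: leq_trans n_ge3. Qed.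
Let n1 : 1 <= n%:R :> R. Proof. by rewrite ler1n. Qed.
Let dn : d%:R <= n%:R :> R. Proof. by rewrite ler_nat. Qed.
Let l1 : 1 < l. Proof. exact: one_lt_ln. Qed.
Let p0 x : 0 <= p x. Proof. exact: mixture_pmf_ge0. Qed.
Let f0 x j : 0 <= fstar x j. Proof. exact: bayes_ge0. Qed.
Let psi0 x : 0 <= n%:R * p x * expR (- (n%:R * p x / 4)).
Proof. by rewrite !mulr_ge0 ?expR_ge0. Qed.

Lemma regret_bounded_support h : P [set t | forall j, theta j t <= h] = 1%E ->
  (regret P theta fhat <= (31 * 1000 * (d%:R / n%:R) *
     Num.max 10 (4 * h) ^+ (d + 2) * (l / ln l) ^+ (d + 1))%:E)%E.
Proof.
move=> Ph; pose j0 := Ordinal d_gt0.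
have h0 : 0 <= h := support_bound_ge0 theta0 j0 Ph.
have l0 : 0 < l := lt_trans ltr01 l1.
have l1' := l1.
set ll := ln l; have ll0 : 0 < ll by exact: ln_gt0.
set L := l / ll; have L1 : 1 < L.
  by rewrite ltr_pdivlMr// mul1r ln_sublinear.
(* In [y], the 4 yields the tail [n ^ (-4)] and [2 h] offsets the exponential moment at
   [2 ln n - 1], the larger of the two used. The extra 1 in [H] absorbs rounding up, as [1 < L]. *)
pose H := 5 + 2 * h; pose y := (4 + 2 * h) * L.
have L0 : 0 <= L by exact: le_trans (ltW L1).
have Lll : L * ll = l by rewrite divfK ?gt_eqF.
clearbody L.
have y0 : 0 <= y by apply: mulr_ge0 => //; lra.
have /andP[Mtrunc My] := truncn_itv y0.
set M := (Num.truncn y).+1 in My.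
have MX : M%:R <= H * L.
  rewrite /M -natr1; apply: (@le_trans _ _ (y + 1)); first by rewrite lerD2r.
  by rewrite /y /H; lra.
(* The Chernoff base [ln n] turns the truncation level [L = ln n / ln ln n] into
   a polynomially small tail, for [l ^ - L = 1 / n]. *)
have b1 : 1 <= l by exact: ltW.
have decay : l ^- M <= expR (- ((4 + 2 * h) * l)).
  have -> : l ^- M = expR (- (M%:R * ll)) by rewrite expRN expRM_natl lnK.
  rewrite ler_expR lerN2 (_ : (4 + 2 * h) * l = y * ll).
    by rewrite ler_pM2r// ltW.
  by rewrite /y -mulrA Lll.
have w4 : w ^+ 4 = expR (- (4 * l)) by rewrite expR_N4ln.
have fh x j : fstar x j <= h by exact: bayes_le.
have zero (F : pt d -> R) : (forall x, F x = 0) -> (expect p F <= 0%:E)%E.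
  by move=> F0; rewrite /expect esum1// => x _; rewrite F0 mulr0.
have fB x j : (h < fstar x j)%R%:R = 0 :> R by rewrite ltNge fh.
apply: (le_trans (@regret_erm_le R d n d0 T P theta n_gt0 mtheta theta0 fhat M
  h 0 0 0 (w ^+ 4) (3 * w ^+ 4) (M%:R ^+ d.-1 * (46 + 100 * h)) h0 erm _ _ _ _ _ _)).
- by move=> j; apply: zero => x; rewrite fB.
- by move=> j; apply: zero => x; rewrite fB mulr0.
- by move=> j; apply: zero => x; rewrite fB mulr0.
- move=> k; have c0 : 0 <= l - 1 by lra.
  have E := integral_expR_bounded mtheta k c0 Ph.
  apply: (le_trans (pmf_tail mtheta theta0 M b1 E)).
  rewrite lee_fin w4; apply: (le_trans (ler_wpM2r (expR_ge0 _) decay)).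
  by rewrite -expRD ler_expR; have := mulr_ge0 h0 (ltW l0); lra.
- move=> k; have e01 : 0 < 1 :> R by [].
  have e11 : 1 <= 1 :> R by [].
  have c0 : 0 <= l * (1 + 1) - 1 by lra.
  have E := integral_expR_bounded mtheta k c0 Ph.
  apply: (le_trans (pmf_tail_sqr mtheta theta0 M b1 e01 e11 E)).
  rewrite lee_fin w4 expr1n divr1 -mulrA ler_wpM2l//.
  apply: (le_trans (ler_wpM2r (expR_ge0 _) decay)).
  by rewrite -expRD ler_expR; have := mulr_ge0 h0 (ltW l0); lra.
- move=> j; apply: (@le_trans _ _ (\sum_(c : {ffun 'I_d -> 'I_M})
    n%:R * p (cell_pt c) * expR (- (n%:R * p (cell_pt c) / 4)))).
    by apply: ler_sum => c _; case: ifP.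
  apply: (sum_cells_occupancy (j := j) (p := fun x => n%:R * p x)) => //.
    by move=> x; rewrite mulr_ge0.
  move=> x; rewrite mulrCA -/(moment1 P theta x j) -bayesE// mulrCA.
  by rewrite ler_wpM2r// mulr_ge0.
rewrite lee_fin.
have X1 : 1 <= H * L by rewrite -[leLHS]mul1r ler_pM// /H; lra.
have HX : H <= H * L by rewrite ler_peMr// /H; lra.
have U1 : 1 <= (H * L) ^+ d.-1 by exact: exprn_ege1.
have MU : M%:R ^+ d.-1 <= (H * L) ^+ d.-1 :> R.
  by rewrite lerXn2r// nnegrE; lra.
have := bounded_case_arith n1 (ler0n R d) dn h0 erefl HX (ler0n R M) MX
  (exprn_ge0 d.-1 (ler0n R M)) MU U1.
have -> : M%:R * M%:R ^+ d.-1 = M%:R ^+ d :> R by rewrite -exprS prednK.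
move=> /le_trans; apply.
have regroup (a b : R) :
    a * (a * b) * (a * b * (a * b) ^+ d.-1) = a ^+ (d + 2) * b ^+ (d + 1).
  rewrite -exprS prednK// exprMn !exprD expr1.
  by move: (a ^+ d) (b ^+ d) => u v; ring.
rewrite regroup.
have C0 : 0 <= 31 * 1000 :> R by lra.
have m10 : 0 <= Num.max 10 (4 * h) :> R by rewrite le_max; apply/orP; left; lra.
(* A sum is at most twice the larger summand, which gives the constants 10 and 4. *)
have Hmax : H <= Num.max 10 (4 * h).
  by rewrite le_max /H; case: (lerP (5 + 2 * h) 10) => //= h5; lra.
have H0 : 0 <= H by rewrite /H; lra.
move: (31 * 1000) (Num.max _ _) C0 m10 Hmax => C m C0 m10 Hmax.
rewrite -[leRHS]mulrA; apply: ler_wpM2l.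
  by rewrite mulr_ge0// mulr_ge0// invr_ge0.
apply: ler_wpM2r; first exact: exprn_ge0.
by rewrite lerXn2r// nnegrE.
Qed.

(** [(1 + 1 / c)^-1 = 1 - 1 / (c + 1) <= exp (- 1 / (c + 1))], and [M] is at least
    [4 (c + 1) ln n]. *)
Lemma pow_decay (c : R) (M : nat) s : 0 < c -> c <= 4 * s ->
  4 * (4 * s + 1) * l <= M%:R -> (1 + c^-1) ^- M <= w ^+ 4.
Proof.
move=> c0 cs Ms; rewrite -expR_N4ln//.
have inv : (1 + c^-1)^-1 <= expR (- (c + 1)^-1).
  apply: le_trans (expR_ge1Dx _).
  have -> : (1 + c^-1)^-1 = 1 - (c + 1)^-1; last by [].
  by field; rewrite !gt_eqF//; lra.
have i0 : 0 < 1 + c^-1 by have : 0 < c^-1 by [rewrite invr_gt0]; lra.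
rewrite -exprVn; apply: (@le_trans _ _ (expR (- (c + 1)^-1) ^+ M)).
  by rewrite lerXn2r// nnegrE ?invr_ge0 ?expR_ge0// ltW.
rewrite -expRM_natl ler_expR mulrN lerN2 ler_pdivlMr; last by lra.
apply: le_trans Ms; have l0 : 0 < l := lt_trans ltr01 l1.
have : (c + 1) * l <= (4 * s + 1) * l by apply: ler_wpM2r; lra.
lra.
Qed.

Lemma regret_subexp s : 0 < s ->
  (forall j (t : R), 0 < t ->
    (P [set u | (t <= theta j u)%R] <= (2 * expR (- (t / s)))%:E)%E) ->
  (regret P theta fhat <= (31 * 1000 * (d%:R / n%:R) *
     (Num.max 10 (32 * s) * l) ^+ (d + 2))%:E)%E.
Proof.
move=> s0 tail; have l0 : 0 < l := lt_trans ltr01 l1.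
have l1' := l1.
(* [B] makes [exp (- B / (4 s))] equal to [n ^ (-4)], the next line takes the threshold of
   [pow_decay], and [X] dominates both [B] and the rounded-up threshold. *)
pose X := (16 * s + 5) * l; pose B := 16 * s * l.
pose y := 4 * (4 * s + 1) * l.
have sl : 0 <= s * l by rewrite mulr_ge0// ltW.
have y0 : 0 <= y by rewrite /y; lra.
have /andP[Mtrunc My] := truncn_itv y0.
set M := (Num.truncn y).+1 in My.
have MX : M%:R <= X.
  rewrite /M -natr1; apply: (@le_trans _ _ (y + 1)); first by rewrite lerD2r.
  by rewrite /y /X; lra.
have B0 : 0 <= B by rewrite /B; lra.
have BX : B <= X by rewrite /B /X; lra.
have s4X : 4 * s + 1 <= X.
  have : (16 * s + 5) * 1 <= X by rewrite ler_wpM2l; lra.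
  by lra.
have EB : expR (- (B / (4 * s))) = w ^+ 4.
  rewrite -expR_N4ln//; congr (expR (- _)).
  by rewrite /B; field; rewrite gt_eqF.
have mgf k := integral_expR_subexp mtheta theta0 s0 (tail k).
have trunc j (q : nat) : (q <= 2)%N ->
    (expect p (fun x => fstar x j ^+ q * (B < fstar x j)%R%:R)%R <=
     (384 * s ^+ q * w ^+ 4)%:E)%E.
  move=> q2; have c0 : 0 <= (2 * s)^-1 by rewrite invr_ge0; lra.
  have := @expect_trunc _ _ _ _ P theta mtheta theta0 (fstar ^~ j) s 12 B q s0 q2
    (fun x => f0 x j) (le_trans (expect_expR_bayes P mtheta theta0 j c0) (mgf j)).
  rewrite EB => /le_trans; apply; rewrite lee_fin le_eqVlt; apply/orP; left.
  by apply/eqP; ring.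
have s20 : 0 < 2 * s by lra.
have s40 : 0 < 4 * s by lra.
apply: (le_trans (@regret_erm_le R d n d0 T P theta n_gt0 mtheta theta0 fhat M
  B (384 * w ^+ 4) (384 * s * w ^+ 4) (384 * s ^+ 2 * w ^+ 4) (12 * w ^+ 4)
  (36 * (4 * s + 1) ^+ 2 * w ^+ 4) (4 * M%:R ^+ d) B0 erm _ _ _ _ _ _)).
- move=> j; have := trunc j 0%N isT; rewrite expr0 mulr1.
  by rewrite (eq_expect _ (G := fun x => (B < fstar x j)%R%:R)) => [//|x];
    rewrite expr0 mul1r.
- move=> j; have := trunc j 1%N isT; rewrite expr1.
  by rewrite (eq_expect _ (G := fun x => fstar x j * (B < fstar x j)%R%:R)) => [//|x];
    rewrite expr1.
- by move=> j; exact: trunc.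
(* With this base, the exponential moment required is exactly the one in [mgf]. *)
- move=> k; have b1 : 1 <= 1 + (2 * s)^-1 by rewrite lerDl invr_ge0 ltW.
  have E := mgf k; rewrite -[(2 * s)^-1](addrK 1) [_ + 1]addrC in E.
  apply: (le_trans (pmf_tail mtheta theta0 M b1 E)).
  have c12 : 0 <= 12 :> R by lra.
  have s24 : 2 * s <= 4 * s by lra.
  have dec := pow_decay s20 s24 (ltW My).
  by rewrite lee_fin mulrC; exact: (ler_wpM2l c12 dec).
- move=> k; have b1 : 1 <= 1 + (4 * s)^-1 by rewrite lerDl invr_ge0 ltW.
  have e0 : 0 < (4 * s + 1)^-1 by rewrite invr_gt0; lra.
  have e1 : (4 * s + 1)^-1 <= 1 by rewrite invf_le1; lra.
  have E := mgf k.
  (* The base [1 + 1 / (2 s)] is factored into a tail part and a part reserved for the square, so no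
     larger exponential moment is needed. *)
  rewrite (_ : (2 * s)^-1 = (1 + (4 * s)^-1) * (1 + (4 * s + 1)^-1) - 1) in E; last first.
    by field; apply/andP; split; apply/eqP; lra.
  apply: (le_trans (pmf_tail_sqr mtheta theta0 M b1 e0 e1 E)).
  have -> : 3 / (4 * s + 1)^-1 ^+ 2 * (1 + (4 * s)^-1) ^- M * 12 =
      36 * (4 * s + 1) ^+ 2 * (1 + (4 * s)^-1) ^- M.
    by rewrite exprVn invrK; ring.
  have c36 : 0 <= 36 * (4 * s + 1) ^+ 2 by rewrite mulr_ge0// sqr_ge0.
  by rewrite lee_fin; exact: (ler_wpM2l c36 (pow_decay s40 (lexx _) (ltW My))).
(* The constant bound 4 per cell is enough here, as the target rate has room for all [M ^ d]
   cells. *)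
- move=> j; apply: (@le_trans _ _ (\sum_(c : {ffun 'I_d -> 'I_M}) 4)).
    by apply: ler_sum => c _; case: ifP => // _; exact: mul_expRN_le4.
  by rewrite sumr_const card_ffun !card_ord -(mulr_natr _ (M ^ d)) natrX.
rewrite lee_fin.
have X1 : 1 <= X by lra.
have U1 : 1 <= X ^+ d by exact: exprn_ege1.
have MU : M%:R ^+ d <= X ^+ d by rewrite lerXn2r// nnegrE; lra.
have := subexp_case_arith n1 (ler0n R d) dn (ltW s0) s4X B0 BX (ler0n R M) MX
  (exprn_ge0 d (ler0n R M)) MU U1.
move=> /le_trans; apply.
have C0 : 0 <= 31 * 1000 :> R by lra.
have Smax : 16 * s + 5 <= Num.max 10 (32 * s).
  by rewrite le_max; case: (lerP (16 * s + 5) 10) => //= h5; lra.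
have m10 : 0 <= Num.max 10 (32 * s) :> R by rewrite le_max; apply/orP; left; lra.
have Xmax : X <= Num.max 10 (32 * s) * l by rewrite ler_pM2r.
have X0 : 0 <= X by lra.
move: (31 * 1000) (Num.max _ _) C0 m10 Xmax {Smax} => C m C0 m10 Xmax.
apply: ler_wpM2l; first by rewrite mulr_ge0// mulr_ge0// invr_ge0.
rewrite -exprD addnC lerXn2r// nnegrE// mulr_ge0//; exact: ltW.
Qed.

End Rates.

Theorem theorem2 (R : realType) :
  exists C c1 c2 c3 c4 : R,
    [/\ 0 < C, 0 < c1, 0 < c2, 0 < c3 & 0 < c4] /\
    forall (d n : nat), (1 <= d)%N -> (maxn d 3 <= n)%N ->
    forall (d0 : measure_display) (T : measurableType d0)
           (P : probability T R) (theta : 'I_d -> T -> R),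
      (forall j, measurable_fun [set: T] (theta j)) ->
      (forall j t, 0 <= theta j t) ->
    forall fhat : sample d n -> estimator R d,
      (forall s, is_erm s (fhat s)) ->
      (forall h : R,
         P [set t | forall j, theta j t <= h] = 1%E ->
         (regret P theta fhat <=
           (C * (d%:R / n%:R) * Num.max c1 (c2 * h) ^+ (d + 2)
             * (ln n%:R / ln (ln n%:R)) ^+ (d + 1))%:E)%E) /\
      (forall s : R, 0 < s ->
         (forall j (t : R), 0 < t ->
            (P [set u | (t <= theta j u)%R] <= (2 * expR (- (t / s)))%:E)%E) ->
         (regret P theta fhat <=
           (C * (d%:R / n%:R) * (Num.max c3 (c4 * s) * ln n%:R) ^+ (d + 2))%:E)%E).
Proof.
exists (31 * 1000), 10, 4, 10, 32; split; first by split; lra.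
move=> d n d1; rewrite geq_max => /andP[dn n3] d0 T P theta mtheta theta0 fhat erm.
split=> [h|s]; first exact: regret_bounded_support.
exact: regret_subexp.
Qed.
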